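(* Let $d,m\ge 1$ be integers and let $f\in\mathcal{D}(\mathbb{R}^d)'$ be a complex valued Schwartz distribution such that $$\widetilde{\Delta}_y^{m}f(x):= (-1)^m f(x)\cdot 1(y)+\sum_{i=1}^m\binom{m}{i}(-1)^{m-i}f(I_dx+(iI_d)y)=0,$$ where the equality is understood in the sense of $\mathcal{D}(\mathbb{R}^d\times\mathbb{R}^d)'$ and $I_d$ is the $d\times d$ identity matrix. Then $f$ is equal almost everywhere to a continuous polynomial function on $\mathbb{R}^d$ of total degree at most $m-1$.
   Context: $\mathcal{D}(\mathbb{R}^d)'$ is the space of complex valued Schwartz distributions on $\mathbb{R}^d$. That a distribution is equal almost everywhere to a polynomial function means that it equals, as a distribution, the one defined by an ordinary polynomial with complex coefficients in $d$ real variables; the zero polynomial satisfies every degree bound. For $f\in\mathcal{D}(\mathbb{R}^d)'$ and $b,c\in\mathbf{GL}_d(\mathbb{R})$, the distribution $f(bx+cy)\in\mathcal{D}(\mathbb{R}^d\times\mathbb{R}^d)'$ is determined by its values on products of test functions $\varphi_1,\varphi_2\in\mathcal{D}(\mathbb{R}^d)$: $$f(bx+cy)\{\varphi_1(x)\varphi_2(y)\}=f\left\{\frac{1}{|\det b|\,|\det c|}\,\sigma_{b^{-1}}(\varphi_1)\ast\sigma_{c^{-1}}(\varphi_2)\right\},\qquad \sigma_{b^{-1}}(\varphi)(x)=\varphi(b^{-1}x),$$ where $\ast$ is convolution. The distribution $f(x)\cdot 1(y)\in\mathcal{D}(\mathbb{R}^d\times\mathbb{R}^d)'$ is the tensor product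 of $f$ with the constant function $1$: $(f(x)\cdot 1(y))\{\varphi_1(x)\varphi_2(y)\}=f\{\varphi_1\}\int_{\mathbb{R}^d}\varphi_2(y)\,dy$. *)

(* Defs.v *)
From mathcomp Require Import all_boot all_order all_algebra.
From mathcomp Require Import all_classical all_reals all_analysis.
From mathcomp Require Import complex.
From mathcomp Require mpoly.
Import numFieldNormedType.Exports.
Import Order.TTheory GRing.Theory Num.Theory.

Set Implicit Arguments.
Unset Strict Implicit.
Unset Printing Implicit Defensive.

Local Open Scope classical_set_scope.
Local Open Scope ring_scope.
Local Open Scope complex_scope.

(* Points of R^n are row vectors 'rV[R]_n, so the
   action of a matrix b on a point x is x *m b^T. The space R^d x R^d is
   'rV[R]_(d + d), a pair (x, y) being row_mx x y. *)

(* Iterated partial derivative along a list of coordinates; the multi-index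
   alpha corresponds to the lists with alpha_i occurrences of each i. *)
Definition partials (R : realType) (n : nat) (s : seq 'I_n)
    (g : 'rV[R]_n -> R) : 'rV[R]_n -> R :=
  foldr (fun (i : 'I_n) (h : 'rV[R]_n -> R) (x : 'rV[R]_n) =>
           'D_(delta_mx 0 i : 'rV[R]_n) h x) g s.

Definition partialsC (R : realType) (n : nat) (s : seq 'I_n)
    (phi : 'rV[R]_n -> R[i]) (x : 'rV[R]_n) : R[i] :=
  partials s (fun z => complex.Re (phi z)) x
  +i* partials s (fun z => complex.Im (phi z)) x.

(* Infinitely differentiable: every iterated partial derivative is (Frechet)
   differentiable at every point. *)
Definition smooth (R : realType) (n : nat) (g : 'rV[R]_n -> R) : Prop :=
  forall (s : seq 'I_n) (x : 'rV[R]_n), differentiable (partials s g) x.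

Definition support_of (R : realType) (n : nat) (phi : 'rV[R]_n -> R[i]) :
    set 'rV[R]_n := closure [set x | phi x != 0].

Definition test_function (R : realType) (n : nat) (phi : 'rV[R]_n -> R[i]) :
    Prop :=
  [/\ smooth (fun x => complex.Re (phi x)),
      smooth (fun x => complex.Im (phi x))
    & compact (support_of phi)].

(* max over |alpha| <= N of the supremum of |D^alpha phi| *)
Definition seminorm (R : realType) (n N : nat) (phi : 'rV[R]_n -> R[i]) : R :=
  sup [set r | exists (s : seq 'I_n) (x : 'rV[R]_n),
         (size s <= N)%N /\ r = Normc.normc (partialsC s phi x)].

(* A distribution on R^n is a functional on D(R^n). Functionals are total
   functions on 'rV[R]_n -> R[i], but only their values on test functions are
   constrained, used, or compared. Continuity is expressed by the usual
   seminorm estimates on each compact set. *)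
Definition is_distribution (R : realType) (n : nat)
    (f : ('rV[R]_n -> R[i]) -> R[i]) : Prop :=
  (forall (a : R[i]) (phi psi : 'rV[R]_n -> R[i]),
      test_function phi -> test_function psi ->
      f (fun x => a * phi x + psi x) = a * f phi + f psi) /\
  (forall K : set 'rV[R]_n, compact K ->
     exists (C : R) (N : nat), forall phi : 'rV[R]_n -> R[i],
       test_function phi -> support_of phi `<=` K ->
       Normc.normc (f phi) <= C * seminorm N phi).

(* Lebesgue integral over R^n as an iterated one-dimensional Lebesgue integral.
   By Fubini this is the integral against n-dimensional Lebesgue measure for
   continuous functions with compact support, the only ones it is used for. *)
Fixpoint integral_rV (R : realType) (n : nat) : ('rV[R]_n -> R) -> R :=
  match n return ('rV[R]_n -> R) -> R with
  | 0 => fun g => g 0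
  | n'.+1 => fun g =>
      \int[@lebesgue_measure R]_t
        integral_rV (fun v : 'rV[R]_n' => g (row_mx (const_mx t : 'rV[R]_1) v))
  end.

Definition integralC (R : realType) (n : nat) (phi : 'rV[R]_n -> R[i]) : R[i] :=
  integral_rV (fun x => complex.Re (phi x))
  +i* integral_rV (fun x => complex.Im (phi x)).

Definition convolution (R : realType) (n : nat) (phi psi : 'rV[R]_n -> R[i])
    (u : 'rV[R]_n) : R[i] :=
  integralC (fun v => phi (u - v) * psi v).

(* sigma_b(phi)(x) = phi(b x) *)
Definition sigma (R : realType) (n : nat) (b : 'M[R]_n)
    (phi : 'rV[R]_n -> R[i]) (x : 'rV[R]_n) : R[i] := phi (x *m b^T).

(* (x, y) |-> phi1(x) phi2(y) *)
Definition prod_fun (R : realType) (d : nat) (phi1 phi2 : 'rV[R]_d -> R[i])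
    (z : 'rV[R]_(d + d)) : R[i] := phi1 (lsubmx z) * phi2 (rsubmx z).

(* G is the distribution f(bx + cy) on R^d x R^d; since finite sums of products
   phi1(x) phi2(y) are dense in D(R^d x R^d), the product values determine it. *)
Definition is_comp_affine (R : realType) (d : nat)
    (f : ('rV[R]_d -> R[i]) -> R[i]) (b c : 'M[R]_d)
    (G : ('rV[R]_(d + d) -> R[i]) -> R[i]) : Prop :=
  is_distribution G /\
  forall phi1 phi2 : 'rV[R]_d -> R[i],
    test_function phi1 -> test_function phi2 ->
    G (prod_fun phi1 phi2) =
    f (fun u => ((`|\det b| * `|\det c|)^-1)%:C
                * convolution (sigma (invmx b) phi1) (sigma (invmx c) phi2) u).

(* G is the distribution f(x).1(y) on R^d x R^d *)
Definition is_tensor_one (R : realType) (d : nat)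
    (f : ('rV[R]_d -> R[i]) -> R[i])
    (G : ('rV[R]_(d + d) -> R[i]) -> R[i]) : Prop :=
  is_distribution G /\
  forall phi1 phi2 : 'rV[R]_d -> R[i],
    test_function phi1 -> test_function phi2 ->
    G (prod_fun phi1 phi2) = f phi1 * integralC phi2.

(* the distribution defined by the function x |-> p(x_1, ..., x_d) *)
Definition poly_distribution (R : realType) (d : nat)
    (p : mpoly.mpoly d R[i]) (phi : 'rV[R]_d -> R[i]) : R[i] :=
  integralC (fun x => mpoly.meval (fun i : 'I_d => (x 0 i)%:C) p * phi x).

(* Main.v *)
Require Import Defs.
From HB Require Import structures.
From mathcomp Require Import all_boot all_order all_algebra.
From mathcomp Require Import all_classical all_reals all_analysis.
From mathcomp Require Import complex.
From mathcomp Require mpoly.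
From mathcomp Require Import ring lra.
Import numFieldNormedType.Exports.
Import Order.TTheory GRing.Theory Num.Theory.

(** A distribution [f] on [R^d] with vanishing [m]-th differences is a polynomial
    of degree less than [m].

    For test functions [phi], [psi] and a real number [t], let
    [smear phi psi t] be the function mapping [u] to the integral over [y] of
    [phi (u - t *: y) * psi y]. The hypothesis, tested on products of test
    functions and after a change of variables, says that the [m]-th difference
    at [0], with any step [t > 0], of the function mapping [t] to
    [f (smear phi psi t)] vanishes ([difference_eq_complexify]). This function
    is smooth on the whole line, including [t = 0] where its value is [f phi]
    times the integral of [psi] ([real_dist_time_quadratic], [smear0]).

    Two consequences are drawn from this equation.

    - All the derivatives of order [m] of [f] vanish ([difference_eq_kills]).
      Indeed, integrating by parts, [smear phi (D psi) t] is [t ^ m] times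
      [smear (D phi) psi t] when [D] is a derivative of order [m]; hence the
      equation for [D psi] can be divided by [t ^ m], and in the limit [t = 0]
      it says that [m! * f (D phi)] times the integral of [psi] is zero.

    - The distribution [f] is recovered from its values on smeared functions:
      if [psi] has nonzero integral, then [f phi] is a combination of the
      [f (smear phi psi i)] for [1 <= i <= m]. Convolution being commutative
      ([smear_swap]), [f (smear phi psi i)] is up to a factor
      [f (smear psi_i phi 1)], where [psi_i] is a dilation of [psi]. Now
      [f (smear psi_i phi t)] has zero [m]-th derivative in [t], by the first
      consequence, so that Taylor's formula at [0] evaluates it at [t = 1]
      ([taylor_smear]). The Taylor coefficients involve [phi] only through its
      moments, i.e. the integrals of [phi] against monomials of degree less
      than [m] ([smear_deriv_poly_functional]). Hence [f phi] is the integral of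
      [phi] against a fixed polynomial.

    In this way [f] is only ever evaluated on smeared functions, and never has
    to be interchanged with an integral. A test function [psi] with nonzero
    integral is obtained as the square of a nonzero test function; if there is
    none, then the zero polynomial will do.

    The argument is carried out for real valued functionals on real valued test
    functions and applied to the real and imaginary parts of [f]. The analytic
    input is a second order Taylor bound for test functions ([taylor2_le]), which
    gives both the smoothness of [smear phi psi t] and its differentiability in
    [t], and the calculus of the iterated integral, which is developed for
    Lipschitz functions of bounded support. *)

Set Implicit Arguments.
Unset Strict Implicit.
Unset Printing Implicit Defensive.

Local Open Scope ring_scope.
Local Open Scope complex_scope.

(** * Lipschitz functions of bounded support *)

Section Clip.
Variable R : realType.
Local Open Scope classical_set_scope.

Definition vanishes_beyond (V : normedModType R) (M : R) (g : V -> R) :=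
  forall x, M < `|x| -> g x = 0.

(** Fixing one coordinate preserves this class, and so does integrating out the
    remaining ones: a Lipschitz constant is uniform, which is exactly what an
    induction on the dimension of an iterated integral asks for. *)
Definition clipschitz (V : normedModType R) (g : V -> R) :=
  exists M L : R, [/\ 0 <= M, 0 <= L, vanishes_beyond M g &
    forall x y, `|g x - g y| <= L * `|x - y|].

Lemma clipschitz_continuous (V : normedModType R)
    (g : V -> R) : clipschitz g -> continuous g.
Proof.
move=> [M [L [_ L0 _ gL]]] x; apply/cvgrPdist_lt => e e0.
have L1 : 0 < L + 1 by rewrite ltr_wpDl.
near=> y.
apply: (le_lt_trans (gL x y)).
apply: (@le_lt_trans _ _ ((L + 1) * `|x - y|)).
  by rewrite ler_wpM2r// lerDl.
rewrite mulrC -ltr_pdivlMr//.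
near: y; apply: cvgr_dist_lt; last by rewrite divr_gt0.
exact: cvg_id.
Unshelve. all: by end_near. Qed.

Lemma clipschitz_bounded (V : normedModType R) (g : V -> R) :
  clipschitz g -> exists B : R, 0 <= B /\ forall x, `|g x| <= B.
Proof.
move=> [M [L [M0 L0 gM gL]]]; exists (`|g 0| + L * M); split => [|x].
  by rewrite addr_ge0// mulr_ge0.
have [xM|Mx] := leP `|x| M; last by rewrite (gM _ Mx) normr0 addr_ge0// mulr_ge0.
have := gL x 0; rewrite subr0 => gx.
rewrite -[g x](subrK (g 0)) (le_trans (ler_normD _ _))// addrC lerD2l.
by rewrite (le_trans gx)// ler_wpM2l.
Qed.

Lemma clipschitz0 (V : normedModType R) : clipschitz (fun _ : V => 0 : R).
Proof.
by exists 0, 0; split => // x y; rewrite subrr normr0 mul0r.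
Qed.

Lemma clipschitz_lin (V : normedModType R) (a : R) (g h : V -> R) :
  clipschitz g -> clipschitz h -> clipschitz (fun x => a * g x + h x).
Proof.
move=> [M [L [M0 L0 gM gL]]] [M' [L' [M0' L0' gM' gL']]].
exists (M + M'), (`|a| * L + L'); split.
- exact: addr_ge0.
- by rewrite addr_ge0// mulr_ge0.
- move=> x Mx; rewrite gM ?gM' ?mulr0 ?addr0//.
  + by apply: le_lt_trans Mx; rewrite lerDr.
  + by apply: le_lt_trans Mx; rewrite lerDl.
- move=> x y.
  have -> : a * g x + h x - (a * g y + h y) = a * (g x - g y) + (h x - h y) by ring.
  rewrite (le_trans (ler_normD _ _))// mulrDl lerD// normrM -mulrA.
  by rewrite ler_wpM2l.
Qed.

(** Only one factor has to have bounded support: the other one will be a test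
    function seen through an affine map that may be constant. *)
Lemma clipschitzM (V : normedModType R) (g h : V -> R) (L B : R) :
  (forall x y, `|g x - g y| <= L * `|x - y|) -> (forall x, `|g x| <= B) ->
  clipschitz h -> clipschitz (fun x => g x * h x).
Proof.
move=> gL gB hl; have [C [C0 hC]] := clipschitz_bounded hl.
case: hl => M [L' [M0 L'0 hM hL]].
have B0 : 0 <= B by apply: le_trans (gB 0).
exists M, (`|L| * C + B * L'); split => //.
- by rewrite addr_ge0// mulr_ge0.
- by move=> x Mx; rewrite hM// mulr0.
- move=> x y.
  have -> : g x * h x - g y * h y = (g x - g y) * h x + g y * (h x - h y) by ring.
  rewrite (le_trans (ler_normD _ _))// [leRHS]mulrDl !normrM lerD//.
    rewrite mulrAC ler_pM//; apply: (le_trans (gL x y)).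
    by rewrite ler_wpM2r// ler_norm.
  by rewrite -mulrA ler_pM.
Qed.

Lemma clipschitz_affine (V : normedModType R) (g : V -> R) (a : R) (b : V) :
  clipschitz g -> a != 0 -> clipschitz (fun y => g (a *: y + b)).
Proof.
move=> [M [L [M0 L0 gM gL]]] a0; exists ((M + `|b|) / `|a|), (L * `|a|); split.
- by rewrite divr_ge0// addr_ge0.
- by rewrite mulr_ge0.
- move=> y; rewrite ltr_pdivrMr ?normr_gt0// => Hy; apply: gM.
  have : `|a *: y| <= `|a *: y + b| + `|b|.
    by rewrite -[X in `|X| <= _](addrK b) (le_trans (ler_normB _ _)).
  by rewrite normrZ; lra.
- move=> x y; apply: (le_trans (gL _ _)).
  have -> : a *: x + b - (a *: y + b) = a *: (x - y).
    by rewrite opprD addrACA subrr addr0 scalerBr.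
  by rewrite normrZ mulrA.
Qed.

End Clip.

(** * Lebesgue integration on the line *)

Section Line.
Variable R : realType.
Local Open Scope classical_set_scope.
Notation mu := (@lebesgue_measure R).

Lemma Rintegral_vanishes_beyond (g : R -> R) (M a b : R) :
  vanishes_beyond M g -> a <= - M -> M <= b ->
  \int[mu]_t g t = \int[mu]_(t in `[a, b]) g t.
Proof.
move=> gM aM Mb; rewrite [RHS]Rintegral_mkcond; congr (Rintegral _ _ _).
apply/funext => t; rewrite patchE; case: ifPn => // tab; apply: gM.
rewrite ltNge; apply: contra tab => tM; rewrite inE/= in_itv/=.
move: tM; rewrite ler_norml => /andP[t1 t2].
by rewrite (le_trans aM)// (le_trans t2).
Qed.

Lemma clipschitz_integrable (g : R -> R) : clipschitz g ->
    mu.-integrable setT (EFin \o g).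
Proof.
move=> gl; have gc := clipschitz_continuous gl; case: gl => M [L [_ _ gM _]].
have : mu.-integrable `[- M, M] (EFin \o g).
  apply: continuous_compact_integrable; first exact: segment_compact.
  exact: continuous_subspaceT.
rewrite integrable_mkcond//; congr (_.-integrable _ _).
apply/funext => t; rewrite patchE; case: ifPn => // tab /=; rewrite gM//.
rewrite ltNge; apply: contra tab => tM; rewrite inE/= in_itv/=.
by rewrite -ler_norml.
Qed.

Lemma Rintegral_clipschitz_bound (g : R -> R) (M B : R) : clipschitz g -> 0 <= M ->
  vanishes_beyond M g -> (forall t, `|g t| <= B) ->
  `|\int[mu]_t g t| <= B * (2 * M).
Proof.
move=> gl M0 gM gB.
have gi : mu.-integrable `[- M, M] (EFin \o g).
  by apply: integrableS (clipschitz_integrable gl).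
have ci : mu.-integrable `[- M, M] (EFin \o cst B).
  apply: continuous_compact_integrable; first exact: segment_compact.
  by apply: continuous_subspaceT => ?; exact: cvg_cst.
rewrite (Rintegral_vanishes_beyond gM (lexx _) (lexx _)).
apply: le_trans (le_normr_Rintegral _ _) _ => //.
have -> : B * (2 * M) = \int[mu]_(t in `[- M, M]) B.
  rewrite Rintegral_cst//= lebesgue_measure_itv/= lte_fin.
  case: ltP => [_|]; first by rewrite /=; congr (_ * _); ring.
  move=> H; have -> : M = 0 by lra.
  by rewrite !mulr0.

apply: le_Rintegral => //.
exact: integrable_norm.
Qed.

Lemma Rintegral_opp (g : R -> R) : clipschitz g ->
  \int[mu]_t g (- t) = \int[mu]_t g t.
Proof.
move=> gl; have gc := clipschitz_continuous gl; case: gl => M [L [M0 _ gM _]].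
have gM' : vanishes_beyond M (fun t : R => g (- t)).
  by move=> t Mt; apply: gM; rewrite normrN.
rewrite (Rintegral_vanishes_beyond gM' (lexx _) (lexx _)).
rewrite (Rintegral_vanishes_beyond gM (lexx _) (lexx _)).
have := @integration_by_substitution_oppr R g (- M) M.
rewrite opprK => H; rewrite /Rintegral H//; first by rewrite ge0_cp.
exact: continuous_subspaceT.
Qed.

(** The substitution rule, on a segment that contains the supports of both
    integrands. *)
Lemma Rintegral_affine_pos (g : R -> R) (a b : R) : clipschitz g -> 0 < a ->
  \int[mu]_t g t = a * \int[mu]_t g (a * t + b).
Proof.
move=> gl a0; have gc := clipschitz_continuous gl; case: gl => M [L [M0 _ gM _]].
have a0' : a != 0 by rewrite gt_eqF.
(* [a * t + b] maps [-N, N] onto a segment that contains [-M, M]. *)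
set N := (M + `|b|) / a.
have N0 : 0 <= N by rewrite divr_ge0 ?addr_ge0// ltW.
pose F (t : R) := a * t + b.
have gM' : vanishes_beyond N (fun t : R => g (F t)).
  move=> t; rewrite ltr_pdivrMr// => Nt; apply: gM.
  have : a * `|t| <= `|F t| + `|b|.
    rewrite -[X in X * _](ger0_norm (ltW a0)) -normrM.
    rewrite -[a * t](addrK b) (le_trans (ler_normB _ _))//.
  by lra.
have FN : F (- N) <= - M.
  have := ler_norm b; have : a * N = M + `|b| by rewrite /N mulrC divfK.
  by rewrite /F; lra.
have NF : M <= F N.
  have := ler_norm (- b); have : a * N = M + `|b| by rewrite /N mulrC divfK.
  by rewrite /F normrN; lra.
have dF (x : R) : is_derive x (1 : R) F a.
  by apply: is_derive_eq; rewrite addr0 [_ *: _]mulr1.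
have F'E : derive1 F = cst a.
  by apply/funext => x; rewrite derive1E derive_val.
have cF : continuous F.
  move=> x; apply: differentiable_continuous; apply/derivable1_diffP.
  exact: ex_derive.
rewrite (Rintegral_vanishes_beyond gM' (lexx _) (lexx _)).
rewrite (Rintegral_vanishes_beyond gM FN NF).
rewrite {1}/Rintegral integration_by_substitution_increasing//.
- rewrite -RintegralZl//; last first.
    apply: continuous_compact_integrable; first exact: segment_compact.
    apply: continuous_subspaceT => x; apply: continuous_comp; first exact: cF.
    exact: gc.
  rewrite /Rintegral; congr fine; apply: eq_integral => t _.
  by rewrite F'E/= mulrC.
- by rewrite ge0_cp.
- by move=> x y _ _ xy; rewrite /F ltrD2r ltr_pM2l.
- by rewrite F'E => x _; exact: cvg_cst.
- by rewrite F'E; exact: is_cvg_cst.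
- by rewrite F'E; exact: is_cvg_cst.
- split; first by move=> x _; exact: ex_derive.
  + exact/cvg_at_right_filter/cF.
  + exact/cvg_at_left_filter/cF.
- exact: continuous_subspaceT.
Qed.

Lemma Rintegral_affine (g : R -> R) (a b : R) : clipschitz g -> a != 0 ->
  \int[mu]_t g (a * t + b) = `|a|^-1 * \int[mu]_t g t.
Proof.
move=> gl a0.
have [a_lt0|a_gt0|a_eq0] := ltgtP a 0; last by rewrite a_eq0 eqxx in a0.
- rewrite (@Rintegral_affine_pos g (- a) b)// ?oppr_gt0//.
  rewrite ltr0_norm// mulKf ?oppr_eq0//.
  rewrite -(@Rintegral_opp (fun t => g (a * t + b)));
    last exact: (@clipschitz_affine R^o).
  by congr (Rintegral _ _ _); apply/funext => t; rewrite mulrN mulNr.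
- by rewrite (@Rintegral_affine_pos g a b)// gtr0_norm// mulKf.
Qed.

(** The Lipschitz bound keeps the integrand above half of [g t0] on a segment
    around [t0]. *)
Lemma Rintegral_gt0 (g : R -> R) (t0 : R) : clipschitz g -> (forall t, 0 <= g t) ->
  0 < g t0 -> 0 < \int[mu]_t g t.
Proof.
move=> gl g0 gt0.
have gi := clipschitz_integrable gl.
have [M [L [M0 L0 gM gL]]] := gl.
have L1 : 0 < L + 1 by rewrite ltr_wpDl.
(* The denominator is [L + 1] because [L] may be zero. *)
pose e := g t0 / 2 / (L + 1).
have e0 : 0 < e by rewrite !divr_gt0.
have gi' : mu.-integrable `[t0 - e, t0 + e] (EFin \o g).
  by apply: integrableS gi.
have ci : mu.-integrable `[t0 - e, t0 + e] (EFin \o cst (g t0 / 2)).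
  apply: continuous_compact_integrable; first exact: segment_compact.
  by apply: continuous_subspaceT => ?; exact: cvg_cst.
apply: (@lt_le_trans _ _ (\int[mu]_(t in `[t0 - e, t0 + e]) (g t0 / 2))).
  rewrite Rintegral_cst//= lebesgue_measure_itv/= lte_fin ifT; last by lra.
  by rewrite /= mulr_gt0 ?divr_gt0//; lra.
apply: (@le_trans _ _ (\int[mu]_(t in `[t0 - e, t0 + e]) g t)).
  apply: le_Rintegral => // t /=; rewrite in_itv/= => te.
  have := gL t0 t; rewrite ler_norml => /andP[_].
  have : `|t0 - t| <= e by rewrite ler_norml; lra.
  move=> /(ler_wpM2l L0) H1 H2.
  have : L * e <= g t0 / 2.
    rewrite /e mulrA ler_pdivrMr// mulrC ler_wpM2l//; last by rewrite lerDl.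
    by rewrite divr_ge0.
  by lra.
rewrite Rintegral_mkcond; apply: le_Rintegral => //.
  by rewrite -restrict_EFin -integrable_mkcond.
by move=> t _; rewrite patchE; case: ifPn.
Qed.

End Line.

(** * The iterated integral on R^n *)

Section IterInt.
Variable R : realType.
Local Open Scope classical_set_scope.
Notation mu := (@lebesgue_measure R).

Lemma coord_le_norm n (v : 'rV[R]_n) (i : 'I_n) : `|v 0 i| <= `|v|.
Proof.
rewrite [leRHS]/Num.norm/= mx_normrE.
by apply/bigmax_geP; right; exists (0, i).
Qed.

Lemma norm_rV_le n (v : 'rV[R]_n) (c : R) : 0 <= c ->
  (forall i, `|v 0 i| <= c) -> `|v| <= c.
Proof.
move=> c0 vc; rewrite [leLHS]/Num.norm/= mx_normrE.
by apply/bigmax_leP; split => // -[j i] _ /=; rewrite ord1.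
Qed.

Definition cons_rV n (t : R) (v : 'rV[R]_n) : 'rV[R]_n.+1 :=
  row_mx (const_mx t : 'rV[R]_1) v.

Lemma cons_rV0 n t (v : 'rV[R]_n) : cons_rV t v 0 0 = t.
Proof.
have := row_mxEl (const_mx t : 'rV[R]_1) v 0 0; rewrite [RHS]mxE => {2}<-.
by congr (row_mx _ _ _ _); exact/val_inj.
Qed.

Lemma cons_rVS n t (v : 'rV[R]_n) i : cons_rV t v 0 (lift ord0 i) = v 0 i.
Proof.
rewrite -(row_mxEr (const_mx t : 'rV[R]_1) v 0 i).
by congr (row_mx _ _ _ _); exact/val_inj.
Qed.

Lemma cons_rV_ext n t (v : 'rV[R]_n) (w : 'rV[R]_n.+1) :
  w 0 0 = t -> (forall i, w 0 (lift ord0 i) = v 0 i) -> w = cons_rV t v.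
Proof.
move=> wt wv; apply/rowP => j; case: (unliftP 0 j) => [i|] ->.
  by rewrite wv cons_rVS.
by rewrite wt cons_rV0.
Qed.

Lemma cons_rVD n (t s : R) (v w : 'rV[R]_n) :
  cons_rV t v + cons_rV s w = cons_rV (t + s) (v + w).
Proof.
by apply: cons_rV_ext => [|i]; rewrite mxE ?cons_rV0// !cons_rVS mxE.
Qed.

Lemma cons_rVZ n (a t : R) (v : 'rV[R]_n) :
  a *: cons_rV t v = cons_rV (a * t) (a *: v).
Proof.
by apply: cons_rV_ext => [|i]; rewrite mxE ?cons_rV0// !cons_rVS mxE.
Qed.

Lemma cons_rV_eta n (w : 'rV[R]_n.+1) :
  w = cons_rV (w 0 0) (\row_i w 0 (lift ord0 i)).
Proof. by apply: cons_rV_ext => // i; rewrite mxE. Qed.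

Lemma norm_cons_rV_ge n t (v : 'rV[R]_n) : `|t| <= `|cons_rV t v| /\
  `|v| <= `|cons_rV t v|.
Proof.
split; first by rewrite -[X in `|X| <= _](cons_rV0 t v) coord_le_norm.
by apply: norm_rV_le => // i; rewrite -(cons_rVS t v) coord_le_norm.
Qed.

Lemma norm_cons_rVB_le n (t s : R) (v w : 'rV[R]_n) :
  `|cons_rV t v - cons_rV s w| <= `|t - s| + `|v - w|.
Proof.
rewrite -[- cons_rV s w]scaleN1r cons_rVZ cons_rVD.
apply: norm_rV_le => [|j]; first exact: addr_ge0.
rewrite mulN1r scaleN1r; case: (unliftP 0 j) => [i|] ->.
  by rewrite cons_rVS (le_trans (coord_le_norm _ _))// lerDr.
by rewrite cons_rV0 lerDl.
Qed.

Lemma clipschitz_slice n (g : 'rV[R]_n.+1 -> R) t :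
  clipschitz g -> clipschitz (fun v => g (cons_rV t v)).
Proof.
move=> [M [L [M0 L0 gM gL]]]; exists M, L; split => //.
  by move=> v Mv; apply: gM; exact: lt_le_trans (norm_cons_rV_ge t v).2.
move=> v w; apply: (le_trans (gL _ _)); rewrite ler_wpM2l//.
by rewrite (le_trans (norm_cons_rVB_le _ _ _ _))// subrr normr0 add0r.
Qed.

Lemma integral_rVS n (g : 'rV[R]_n.+1 -> R) :
  integral_rV g = \int[mu]_t integral_rV (fun v => g (cons_rV t v)).
Proof. by []. Qed.

Definition integral_linear n :=
  forall (a : R) (g h : 'rV[R]_n -> R), clipschitz g -> clipschitz h ->
    integral_rV (fun x => a * g x + h x) = a * integral_rV g + integral_rV h.

Definition integral_bounded n :=
  forall (g : 'rV[R]_n -> R) (M B : R), clipschitz g -> vanishes_beyond M g ->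
    0 <= M -> (forall x, `|g x| <= B) -> `|integral_rV g| <= B * (2 * M) ^+ n.

Lemma slice_integral_vanishes n (g : 'rV[R]_n.+1 -> R) (M : R) :
  integral_bounded n -> clipschitz g -> vanishes_beyond M g ->
  vanishes_beyond M (fun t : R => integral_rV (fun v => g (cons_rV t v))).
Proof.
move=> Ib gl gM t Mt; apply/eqP; rewrite -normr_le0.
have far v : g (cons_rV t v) = 0.
  by apply: gM; exact: lt_le_trans (norm_cons_rV_ge t v).1.
rewrite -[leRHS](mul0r ((2 * 0) ^+ n)); apply: Ib => //.
- exact: clipschitz_slice.
- by move=> v; rewrite far normr0.
Qed.

(** The difference of two slice integrals is the integral of the difference of
    the slices, which the Lipschitz constant of [g] bounds uniformly. *)
Lemma slice_integral_clipschitz n (g : 'rV[R]_n.+1 -> R) :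
  integral_linear n -> integral_bounded n -> clipschitz g ->
  clipschitz (fun t : R => integral_rV (fun v => g (cons_rV t v))).
Proof.
move=> Il Ib gl; have gl' t := clipschitz_slice t gl.
have [M [L [M0 L0 gM gL]]] := gl.
exists M, (L * (2 * M) ^+ n); split => //.
- by rewrite mulr_ge0// exprn_ge0// mulr_ge0.
- exact: slice_integral_vanishes.
- move=> t s; rewrite -mulN1r addrC -Il// mulrAC.
  apply: Ib => //.
  + exact: clipschitz_lin.
  + move=> v Mv; have far r : g (cons_rV r v) = 0.
      by apply: gM; exact: lt_le_trans (norm_cons_rV_ge _ v).2.
    by rewrite !far mulr0 addr0.
  + move=> v; rewrite mulN1r addrC (le_trans (gL _ _))// ler_wpM2l//.
    by rewrite (le_trans (norm_cons_rVB_le _ _ _ _))// subrr normr0 addr0.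
Qed.

(** Both properties have to be proved together: in dimension [n + 1] either of
    them needs the slice integrals to be integrable, and these are Lipschitz
    by linearity and boundedness in dimension [n]. *)
Lemma integral_rV_lin_bound n : integral_linear n /\ integral_bounded n.
Proof.
elim: n => [|n [Il Ib]].
  by split => // g M B _ _ _ gB; rewrite expr0 mulr1 /=.
split=> [a g h gl hl|g M B gl gM M0 gB]; rewrite !integral_rVS.
  rewrite -RintegralZl//; last exact/clipschitz_integrable/slice_integral_clipschitz.
  rewrite -RintegralD//; last 2 first.
  - apply: clipschitz_integrable.
    have := clipschitz_lin a (slice_integral_clipschitz Il Ib gl) (clipschitz0 R^o).
    by congr clipschitz; apply/funext => t; rewrite addr0.
  - exact/clipschitz_integrable/slice_integral_clipschitz.
  congr (Rintegral _ _ _); apply/funext => t.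
  by rewrite Il//; exact: clipschitz_slice.
rewrite exprSr mulrA; apply: Rintegral_clipschitz_bound => //.
- exact: slice_integral_clipschitz.
- exact: slice_integral_vanishes.
- move=> t; apply: Ib => //; first exact: clipschitz_slice.
  by move=> v Mv; apply: gM; exact: lt_le_trans (norm_cons_rV_ge t v).2.
Qed.

Lemma integral_rV_lin n : integral_linear n.
Proof. exact: (integral_rV_lin_bound n).1. Qed.

Lemma integral_rV_bound n : integral_bounded n.
Proof. exact: (integral_rV_lin_bound n).2. Qed.

Lemma clipschitz_slice_integral n (g : 'rV[R]_n.+1 -> R) : clipschitz g ->
  clipschitz (fun t : R => integral_rV (fun v => g (cons_rV t v))).
Proof.
apply: slice_integral_clipschitz; [exact: integral_rV_lin|exact: integral_rV_bound].
Qed.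

Lemma integral_rV_affine n (g : 'rV[R]_n -> R) (a : R) (b : 'rV[R]_n) :
  clipschitz g -> a != 0 ->
  integral_rV (fun y => g (a *: y + b)) = (`|a| ^+ n)^-1 * integral_rV g.
Proof.
elim: n g b => [|n IH] g b gl a0.
  by rewrite expr0 invr1 mul1r /=; congr g; apply/rowP => -[].
rewrite !integral_rVS [b]cons_rV_eta.
set b0 := b 0 0; set b' := \row_i _.
transitivity (\int[mu]_t ((`|a| ^+ n)^-1 *
    integral_rV (fun v => g (cons_rV (a * t + b0) v)))).
  congr (Rintegral _ _ _); apply/funext => t.
  rewrite -(IH (fun v => g (cons_rV (a * t + b0) v)) b')//;
    last exact: clipschitz_slice.
  by congr integral_rV; apply/funext => v; rewrite cons_rVZ cons_rVD.
rewrite RintegralZl//; last first.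
  apply: clipschitz_integrable.
  exact: (@clipschitz_affine _ R^o _ a b0 (clipschitz_slice_integral gl) a0).
rewrite (@Rintegral_affine _ (fun s => integral_rV (fun v => g (cons_rV s v))))//.
  by rewrite mulrA exprSr invfM.
exact: clipschitz_slice_integral.
Qed.

Lemma integral_rV_ge0 n (g : 'rV[R]_n -> R) :
  (forall x, 0 <= g x) -> 0 <= integral_rV g.
Proof.
elim: n g => [|n IH] g g0 //=.
by apply: Rintegral_ge0 => t _; apply: IH.
Qed.

(** Applied to the square of a nonzero test function, this produces a test
    function with nonzero integral without constructing any bump function. *)
Lemma integral_rV_gt0 n (g : 'rV[R]_n -> R) (x : 'rV[R]_n) : clipschitz g ->
  (forall y, 0 <= g y) -> 0 < g x -> 0 < integral_rV g.
Proof.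
elim: n g x => [|n IH] g x gl g0 gx /=.
  by move: gx; congr (0 < g _); apply/rowP => -[].
apply: (@Rintegral_gt0 _ _ (x 0 0)); first exact: clipschitz_slice_integral.
  by move=> t; apply: integral_rV_ge0.
apply: (IH _ (\row_i x 0 (lift ord0 i))) => //; first exact: clipschitz_slice.
by move: gx; rewrite {1}(cons_rV_eta x).
Qed.

End IterInt.

(** * Smooth functions *)

Section Smooth.
Variable R : realType.
Local Open Scope classical_set_scope.

Definition partial n (i : 'I_n) (g : 'rV[R]_n -> R) : 'rV[R]_n -> R :=
  fun x => 'D_(delta_mx 0 i : 'rV[R]_n) g x.

Lemma partials_cons n (i : 'I_n) (s : seq 'I_n) (g : 'rV[R]_n -> R) :
  partials (i :: s) g = partial i (partials s g).
Proof. by []. Qed.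

Lemma partials_rcons n (i : 'I_n) (s : seq 'I_n) (g : 'rV[R]_n -> R) :
  partials (rcons s i) g = partials s (partial i g).
Proof. by rewrite /partials foldr_rcons. Qed.

Lemma smooth_differentiable n (g : 'rV[R]_n -> R) x : smooth g ->
    differentiable g x.
Proof. by move=> /(_ [::] x). Qed.

Lemma smooth_partial n (g : 'rV[R]_n -> R) i : smooth g -> smooth (partial i g).
Proof. by move=> gs s x; rewrite -partials_rcons. Qed.

Lemma smooth_partials n (g : 'rV[R]_n -> R) s : smooth g -> smooth (partials s g).
Proof. by elim: s => [//|i s IH] gs; apply: smooth_partial; exact: IH. Qed.

(** A class of differentiable functions that is closed under partial
    derivatives consists of smooth functions: this turns the infinitely many
    conditions in the definition of smoothness into two. *)
Lemma smooth_coind n (P : ('rV[R]_n -> R) -> Prop) :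
  (forall g, P g -> (forall x, differentiable g x) /\ forall i, P (partial i g)) ->
  forall g, P g -> smooth g.
Proof.
move=> HP g Pg s; suff : P (partials s g) by move=> /HP[].
by elim: s => [//|i s IH]; exact: (HP _ IH).2.
Qed.

(** The partial derivatives of such an expression are again such expressions,
    by the Leibniz and chain rules, so that [smooth_coind] applies: one
    induction yields all the closure properties of smoothness. The map [A] in
    [SmoothComp] has constant partial derivatives, i.e. it is affine. *)
Inductive smooth_expr n : ('rV[R]_n -> R) -> Prop :=
| SmoothCst c : smooth_expr (fun=> c)
| SmoothCoord i : smooth_expr (fun x => x 0 i)
| SmoothComp p (g : 'rV[R]_p -> R) (A : 'rV[R]_n -> 'rV[R]_p)
    (c : 'I_n -> 'rV[R]_p) : smooth g ->
    (forall x, differentiable A x) ->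
    (forall x i, 'D_(delta_mx 0 i : 'rV[R]_n) A x = c i) ->
    smooth_expr (fun x => g (A x))
| SmoothAdd g h : smooth_expr g -> smooth_expr h -> smooth_expr (fun x => g x + h x)
| SmoothMul g h : smooth_expr g -> smooth_expr h ->
  smooth_expr (fun x => g x * h x).

Lemma derive_coords n (g : 'rV[R]_n -> R) x h : differentiable g x ->
  'D_h g x = \sum_j h 0 j * partial j g x.
Proof.
move=> dg; rewrite deriveE// [in LHS](row_sum_delta h) linear_sum/=.
by apply: eq_bigr => j _; rewrite linearZ/= /partial deriveE.
Qed.

Lemma smooth_expr_sum n p (F : 'I_p -> 'rV[R]_n -> R) :
  (forall i, smooth_expr (F i)) -> smooth_expr (fun x => \sum_i F i x).
Proof.
move=> HF; elim: (index_enum _) => [|i s IH].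
  by under eq_fun do rewrite big_nil; exact: SmoothCst.
by under eq_fun do rewrite big_cons; exact: SmoothAdd.
Qed.

Lemma smooth_expr_differentiable n (g : 'rV[R]_n -> R) :
  smooth_expr g -> forall x, differentiable g x.
Proof.
elim=> [c|i|p {}g A c gs dA dAc|{}g h _ IHg _ IHh|{}g h _ IHg _ IHh] x.
- exact: differentiable_cst.
- exact: differentiable_coord.
- apply: differentiable_comp => //; exact: smooth_differentiable.
- exact: differentiableD.
- exact: differentiableM.
Qed.

Lemma partial_cst n (c : R) (i : 'I_n) :
    partial i (fun _ : 'rV[R]_n => c) = fun=> 0.
Proof. by apply/funext => x; rewrite /partial derive_cst. Qed.

Lemma partials0 n s : partials s (fun _ : 'rV[R]_n => 0 : R) = fun=> 0.
Proof. by elim: s => [//|i s IH]; rewrite partials_cons IH partial_cst. Qed.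

Lemma smooth_expr_partial n (g : 'rV[R]_n -> R) :
  smooth_expr g -> forall i, smooth_expr (partial i g).
Proof.
elim=> [c|j|p {}g A c gs dA dAc|{}g h Hg IHg Hh IHh|{}g h Hg IHg Hh IHh] i.
- by rewrite partial_cst; exact: SmoothCst.
- have -> : partial i (fun x : 'rV[R]_n => x 0 j) = fun=>
  (delta_mx 0 i : 'rV[R]_n) 0 j.
    apply/funext => x; rewrite /partial deriveE; last exact: differentiable_coord.
    have @f : {linear 'rV[R]_n -> R}.
      by exists (fun N : 'rV[R]_n => N 0 j); do 2![eexists]; do ?[constructor];
         rewrite ?mxE// => ? *; rewrite ?mxE//; move=> ?; rewrite !mxE.
    rewrite (_ : (fun _ => _) = f) // diff_lin//; exact/coord_continuous.
  exact: SmoothCst.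
- have -> : partial i (fun x => g (A x)) = fun x =>
  \sum_j c i 0 j * partial j g (A x).
    apply/funext => x; have dgA := smooth_differentiable (A x) gs.
    rewrite {1}/partial deriveE; last exact: differentiable_comp.
    rewrite diff_comp//= -[X in 'd g _ X]deriveE// dAc -deriveE//.
    exact: derive_coords.
  apply: smooth_expr_sum => j; apply: SmoothMul; first exact: SmoothCst.
  exact: (@SmoothComp _ _ _ _ c (smooth_partial j gs)).
- have -> : partial i (fun x => g x + h x) = fun x => partial i g x + partial i h x.
    apply/funext => x; rewrite /partial -deriveD//; apply: diff_derivable;
      exact: smooth_expr_differentiable.
  exact: SmoothAdd.
- have -> : partial i (fun x => g x * h x) = fun x =>
  g x * partial i h x + h x * partial i g x.
    apply/funext => x; rewrite /partial -deriveM//; apply: diff_derivable;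
      exact: smooth_expr_differentiable.
  by apply: SmoothAdd; apply: SmoothMul.
Qed.

Lemma smooth_expr_smooth n (g : 'rV[R]_n -> R) : smooth_expr g -> smooth g.
Proof.
apply: smooth_coind => {}g Hg; split; first exact: smooth_expr_differentiable.
exact: smooth_expr_partial.
Qed.

Lemma smooth_smooth_expr n (g : 'rV[R]_n -> R) : smooth g -> smooth_expr g.
Proof.
move=> gs; apply: (@SmoothComp _ _ g id (fun i => delta_mx 0 i)) => // x i.
by rewrite derive_id.
Qed.

Lemma derive_is_linear n p (L : {linear 'rV[R]_n -> 'rV[R]_p}) x v :
  continuous L -> 'D_v L x = L v.
Proof. by move=> cL; rewrite deriveE ?diff_lin//; exact: linear_differentiable. Qed.

Lemma smooth_expr_affine n (g : 'rV[R]_n -> R) (a : R) (b : 'rV[R]_n) : smooth g ->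
  smooth_expr (fun x => g (a *: x + b)).
Proof.
move=> gs; apply: (@SmoothComp _ _ g (fun x => a *: x + b) (fun i =>
  a *: delta_mx 0 i)) => // x; last first.
  move=> i; have D : derivable ( *:%R a : 'rV[R]_n -> 'rV[R]_n) x (delta_mx 0 i).
    by apply: derivableZ; exact: derivable_id.
  rewrite (deriveD D (derivable_cst b _ _)) derive_cst addr0.
  apply: (@derive_is_linear _ _ ( *:%R a)) => y.
  by apply: differentiable_continuous; exact: differentiableZ.
Qed.

Lemma smooth_expr_lsub d (g : 'rV[R]_d -> R) : smooth g ->
  smooth_expr (fun z : 'rV[R]_(d + d) => g (lsubmx z)).
Proof.
move=> gs; apply: (@SmoothComp _ _ g lsubmx (fun i =>
  lsubmx (delta_mx 0 i))) => // [x|x i].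
  exact: differentiable_lsubmx.
apply: derive_is_linear => {}x; apply: differentiable_continuous.
exact: differentiable_lsubmx.
Qed.

Lemma smooth_expr_rsub d (g : 'rV[R]_d -> R) : smooth g ->
  smooth_expr (fun z : 'rV[R]_(d + d) => g (rsubmx z)).
Proof.
move=> gs; apply: (@SmoothComp _ _ g rsubmx (fun i =>
  rsubmx (delta_mx 0 i))) => // [x|x i].
  exact: differentiable_rsubmx.
apply: derive_is_linear => {}x; apply: differentiable_continuous.
exact: differentiable_rsubmx.
Qed.

Lemma is_derive_line n (g : 'rV[R]_n -> R) x h (t : R) :
  (forall y, differentiable g y) ->
  is_derive t (1 : R) (fun s : R => g (x + s *: h))
    (\sum_j h 0 j * partial j g (x + t *: h)).
Proof.
move=> dg; rewrite -derive_coords//.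
have E : (fun e : R => e^-1 *: (((fun s : R =>
  g (x + s *: h)) \o shift t) (e *: (1 : R))
      - (fun s : R => g (x + s *: h)) t)) =
    (fun e : R => e^-1 *: ((g \o shift (x + t *: h)) (e *: h) - g (x + t *: h))).
  apply/funext => e /=; congr (_ *: (g _ - _)).
  by rewrite [e *: 1]mulr1 scalerDl addrCA.
have D : derivable g (x + t *: h) h by exact: diff_derivable.
split; first by move: D; rewrite /derivable -E.
by rewrite /derive -E.
Qed.

Lemma mean_value n (g : 'rV[R]_n -> R) x h : (forall y, differentiable g y) ->
  exists2 c : R, 0 <= c <= 1 &
    g (x + h) - g x = \sum_j h 0 j * partial j g (x + c *: h).
Proof.
move=> dg; have D t := @is_derive_line n g x h t dg.
have [|t|c c01] := @MVT R (fun s : R => g (x + s *: h))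
    (fun t => \sum_j h 0 j * partial j g (x + t *: h)) 0 1 _ (fun t _ => D t).
- exact: ltr01.
- by move: t; apply: continuous_subspaceT => t; apply: differentiable_continuous;
    apply/derivable1_diffP; exact: ex_derive.
rewrite scale1r scale0r addr0 subr0 mulr1 => ->; exists c => //.
by move: c01; rewrite in_itv/= => /andP[c0 c1]; rewrite !ltW.
Qed.

Lemma sum_coords_le n (h : 'rV[R]_n) (a : 'I_n -> R) (B : R) :
  (forall j, `|a j| <= B) -> `|\sum_j h 0 j * a j| <= n%:R * B * `|h|.
Proof.
move=> aB; apply: (le_trans (ler_norm_sum _ _ _)).
apply: (@le_trans _ _ (\sum_(j < n) B * `|h|)).
  by apply: ler_sum => j _; rewrite normrM mulrC ler_pM// coord_le_norm.
by rewrite sumr_const card_ord -[leLHS]mulr_natl mulrA.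
Qed.

Lemma increment_le n (g : 'rV[R]_n -> R) (B : R) x h :
  (forall y, differentiable g y) -> (forall j y, `|partial j g y| <= B) ->
  `|g (x + h) - g x| <= n%:R * B * `|h|.
Proof.
move=> dg gB; have [c _ ->] := mean_value x h dg.
exact: sum_coords_le.
Qed.

(** The mean value theorem, applied to [g] and then to its partial
    derivatives. *)
Lemma taylor2_le n (g : 'rV[R]_n -> R) (B : R) x h : smooth g -> 0 <= B ->
  (forall i j y, `|partial i (partial j g) y| <= B) ->
  `|g (x + h) - g x - \sum_j h 0 j * partial j g x| <= n%:R ^+ 2 * B * `|h| ^+ 2.
Proof.
move=> gs B0 gB.
have [c /andP[c0 c1] ->] := mean_value x h (fun y => smooth_differentiable y gs).
rewrite -sumrB; under eq_bigr do rewrite -mulrBr.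
have H j : `|partial j g (x + c *: h) - partial j g x| <= n%:R * B * `|h|.
  apply: (le_trans (@increment_le _ (partial j g) B x (c *: h) _ _)).
  - by move=> y; apply: smooth_differentiable; exact: smooth_partial.
  - by move=> i y; exact: gB.
  rewrite ler_wpM2l ?mulr_ge0// normrZ ger0_norm// ler_piMl//.
apply: (le_trans (sum_coords_le _ H)).
by rewrite mulrA mulrA -!expr2 -mulrA -expr2.
Qed.

(** A quadratic remainder is what Taylor's formula leaves under an integral
    sign, where the little-o of differentiability would not be uniform. *)
Lemma differentiable_of_quadratic n (G : 'rV[R]_n -> R) (c : 'I_n -> R) (C : R) u :
  (forall h, `|G (u + h) - G u - \sum_j h 0 j * c j| <= C * `|h| ^+ 2) ->
  differentiable G u /\ forall j, partial j G u = c j.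
Proof.
move=> H.
pose l (h : 'rV[R]_n) := \sum_j h 0 j * c j.
have ll : linear l.
  move=> a x y; rewrite /l scaler_sumr -big_split/=; apply: eq_bigr => j _.
  by rewrite !mxE mulrDl scalerAl.
pose lM := GRing.isLinear.Build _ _ _ _ _ ll.
pose L : {linear 'rV[R]_n -> R} := HB.pack l lM.
have cL : continuous L.
  move=> x; apply: differentiable_continuous.
  have -> : (L : _ -> _) = \sum_j (fun h : 'rV[R]_n => h 0 j * c j).
    by apply/funext => h; rewrite fct_sumE.
  apply: differentiable_sum => j; apply: differentiableM.
    exact: differentiable_coord.
  exact: differentiable_cst.
have E : G \o shift u = cst (G u) + L +o_ (0 : 'rV[R]_n) id.
  apply/eqaddoP => e e0.
  have C1 : 0 < `|C| + 1 by rewrite ltr_wpDl.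
  have N : \forall x \near (0 : 'rV[R]_n), `|x| <= e / (`|C| + 1).
    by apply: nbhs0_le; rewrite divr_gt0.
  near=> h.
  rewrite /= !fctE /=.
  have -> : G (h + u) - (G u + L h) = G (u + h) - G u - l h.
    by rewrite [h + u]addrC opprD addrA.
  apply: (le_trans (H h)).
  rewrite expr2 mulrA ler_wpM2r//.
  apply: (@le_trans _ _ ((`|C| + 1) * `|h|)).
    by rewrite ler_wpM2r// (le_trans (ler_norm _))// lerDl.
  rewrite mulrC -ler_pdivlMr//.
  near: h.
  exact: N.
have dE := diff_unique cL E.
have dG : differentiable G u.
  by apply/diff_locallyP; rewrite dE.
split => // j; rewrite /partial deriveE// dE /= /l (bigD1 j)//= big1 ?addr0.
  by rewrite mxE !eqxx mul1r.
by move=> i ij; rewrite mxE (negbTE ij) andbF mul0r.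
Unshelve. all: by end_near. Qed.

Lemma sum_delta n (i : 'I_n) (h : R) (a : 'I_n -> R) :
  \sum_j (h *: delta_mx 0 i : 'rV[R]_n) 0 j * a j = h * a i.
Proof.
rewrite (bigD1 i)//= big1 ?addr0; first by rewrite !mxE !eqxx mulr1.
by move=> j ji; rewrite !mxE (negbTE ji) andbF mulr0 mul0r.
Qed.

Lemma partial_affine n (g : 'rV[R]_n -> R) (a : R) (b : 'rV[R]_n) i : smooth g ->
  partial i (fun x => g (a *: x + b)) = fun x => a * partial i g (a *: x + b).
Proof.
move=> gs; apply/funext => x.
have H := @is_derive_line n (fun y => g (a *: y + b)) x (delta_mx 0 i) 0.
have dga y : differentiable (fun y => g (a *: y + b)) y.
  by apply: smooth_expr_differentiable; exact: smooth_expr_affine.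
have H' := @is_derive_line n g (a *: x + b) (a *: delta_mx 0 i) 0
  (fun y => smooth_differentiable y gs).
have /@derive_val := H dga.
have -> : (fun s : R => g (a *: (x + s *: delta_mx 0 i) + b)) =
   (fun s : R => g (a *: x + b + s *: (a *: delta_mx 0 i))).
  apply/funext => s; rewrite scalerDr addrAC; congr (g (_ + _)).
  by rewrite !scalerA mulrC.
rewrite (@derive_val _ _ _ _ _ _ _ H').
rewrite sum_delta -[delta_mx 0 i in X in _ = X](scale1r).
by rewrite sum_delta !scale0r !addr0 mul1r => ->.
Qed.

Lemma partial_add n (g h : 'rV[R]_n -> R) i x : smooth g -> smooth h ->
  partial i (fun x => g x + h x) x = partial i g x + partial i h x.
Proof.
move=> gs hs; rewrite /partial -deriveD//; apply: diff_derivable;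
  exact: smooth_differentiable.
Qed.

Lemma partial_scale n (a : R) (g : 'rV[R]_n -> R) i x : smooth g ->
  partial i (fun x => a * g x) x = a * partial i g x.
Proof.
move=> gs; rewrite /partial -[RHS](@deriveZ _ _ _ g a)//; apply: diff_derivable;
  exact: smooth_differentiable.
Qed.

Lemma partial_mul n (g h : 'rV[R]_n -> R) i x : smooth g -> smooth h ->
  partial i (fun x => g x * h x) x = g x * partial i h x + h x * partial i g x.
Proof.
move=> gs hs; rewrite /partial -deriveM//; apply: diff_derivable;
  exact: smooth_differentiable.
Qed.

(** Outside the closed ball, [g] is zero on a neighbourhood of the point. *)
Lemma partial_vanishes n (g : 'rV[R]_n -> R) M i :
  vanishes_beyond M g -> vanishes_beyond M (partial i g).
Proof.
move=> gM x Mx; rewrite /partial -(derive_cst (0 : R) x (delta_mx 0 i : 'rV[R]_n)).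
have [->|i0] := eqVneq (delta_mx 0 i : 'rV[R]_n) 0; first by rewrite !derive0.
apply: near_eq_derive => //.
near=> y; rewrite gM//.
have : `|x| - M > `|x - y|.
  near: y; apply: cvgr_dist_lt; last by rewrite subr_gt0.
  exact: cvg_id.
have := lerB_dist x y.
by lra.
Unshelve. all: by end_near. Qed.

End Smooth.

(* Derivatives are handled through the lemmas above rather than as limits. *)
Opaque partial.

(** * Real test functions *)

Section Test.
Variable R : realType.
Local Open Scope classical_set_scope.

(** Real valued test functions: bounded support is the same as compact support
    in [R^n], and easier to propagate. *)
Definition real_test n (g : 'rV[R]_n -> R) :=
  smooth g /\ exists M, vanishes_beyond M g.

Lemma real_test_smooth n (g : 'rV[R]_n -> R) : real_test g -> smooth g.
Proof. by case. Qed.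

Lemma real_test_radius n (g : 'rV[R]_n -> R) : real_test g ->
  exists M, 0 <= M /\ vanishes_beyond M g.
Proof.
move=> [_ [M gM]]; exists `|M|; split => // x Mx; apply: gM.
exact: le_lt_trans (ler_norm M) Mx.
Qed.

Lemma real_test_partial n (g : 'rV[R]_n -> R) i : real_test g ->
    real_test (partial i g).
Proof.
move=> [gs [M gM]]; split; first exact: smooth_partial.
by exists M; exact: partial_vanishes.
Qed.

Lemma real_test_partials n (g : 'rV[R]_n -> R) s : real_test g ->
    real_test (partials s g).
Proof. by elim: s => [//|i s IH] gs; apply: real_test_partial; exact: IH. Qed.

Lemma ball_closed n (M : R) : closed [set x : 'rV[R]_n | `|x| <= M].
Proof.
have -> : [set x : 'rV[R]_n | `|x| <= M] = Num.norm @^-1` [set r | r <= M].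
  by [].
apply: closed_comp; last exact: closed_le.
by move=> x _; exact: norm_continuous.
Qed.

Lemma ball_compact n (M : R) : compact [set x : 'rV[R]_n | `|x| <= M].
Proof.
apply: bounded_closed_compact; last exact: ball_closed.
exists M; split; first exact: num_real.
by move=> N MN x /= xM; exact: le_trans xM (ltW MN).
Qed.

Lemma real_test_bounded n (g : 'rV[R]_n -> R) : real_test g ->
  exists B : R, 0 <= B /\ forall x, `|g x| <= B.
Proof.
move=> gt; have [M [M0 gM]] := real_test_radius gt.
have gc : continuous g.
  by move=> x; apply: differentiable_continuous; exact: smooth_differentiable gt.1.
have cK := @ball_compact n M.
have : compact (g @` [set x | `|x| <= M]).
  by apply: continuous_compact => //; exact: continuous_subspaceT.
move=> /compact_bounded [B [_ HB]].
exists (`|B| + 1); split; first by rewrite addr_ge0.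
move=> x; have [xM|Mx] := leP `|x| M; last by rewrite gM// normr0 addr_ge0.
apply: (HB (`|B| + 1)); last by exists x.
by rewrite (le_lt_trans (ler_norm B))// ltrDl.
Qed.

(** The induction peels off the innermost derivative, so that the hypothesis is
    used for [partial i g] instead of [g]. *)
Lemma real_test_bounded_partials n (g : 'rV[R]_n -> R) N : real_test g ->
  exists B : R, 0 <= B /\ forall s x, (size s <= N)%N -> `|partials s g x| <= B.
Proof.
elim: N g => [|N IH] g gt; have [B [B0 gB]] := real_test_bounded gt.
  by exists B; split => // -[|//] x _; exact: gB.
have /choice[C HC] : forall i, exists B : R, 0 <= B /\
    forall s x, (size s <= N)%N -> `|partials s (partial i g) x| <= B.
  by move=> i; apply: IH; exact: real_test_partial.
exists (B + \sum_i C i); split.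
  by rewrite addr_ge0// sumr_ge0// => i _; have [] := HC i.
move=> s x; case/lastP: s => [_|s i]; first by
  rewrite (le_trans (gB x))// lerDl sumr_ge0// => i _; have [] := HC i.
rewrite size_rcons ltnS partials_rcons => sN.
apply: le_trans ((HC i).2 _ _ sN) _.
rewrite (bigD1 i)//= addrCA lerDl addr_ge0// sumr_ge0// => k _.
by have [] := HC k.
Qed.

Lemma real_test_lipschitz n (g : 'rV[R]_n -> R) : real_test g ->
  exists L : R, 0 <= L /\ forall x y, `|g x - g y| <= L * `|x - y|.
Proof.
move=> gt; have [B [B0 gB]] := real_test_bounded_partials 1 gt.
exists (n%:R * B); split; first exact: mulr_ge0.
move=> x y; rewrite -{1}(subrK y x) [x - y + y]addrC.
apply: increment_le => [z|i z]; first exact: smooth_differentiable gt.1.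
exact: (gB [:: i]).
Qed.

Lemma real_test_clipschitz n (g : 'rV[R]_n -> R) : real_test g -> clipschitz g.
Proof.
move=> gt; have [L [L0 gL]] := real_test_lipschitz gt.
by have [M [M0 gM]] := real_test_radius gt; exists M, L.
Qed.

Lemma eq0_of_le_linear (a C : R) :
  (forall e, 0 < e -> e <= 1 -> `|a| <= C * e) -> a = 0.
Proof.
move=> H; apply/eqP; rewrite -normr_le0 leNgt; apply/negP => a0.
have C0 : 0 < C by have := H 1 ltr01 (lexx _); lra.
pose e := Num.min 1 (`|a| / (2 * C)).
have C2 : 0 < 2 * C by lra.
have e0 : 0 < e by rewrite lt_min ltr01 divr_gt0.
have e1 : e <= 1 by rewrite ge_min lexx.
have := H e e0 e1; have : e <= `|a| / (2 * C) by rewrite ge_min lexx orbT.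
rewrite ler_pdivlMr//; lra.
Qed.

Lemma norm_delta_le n (i : 'I_n) (h : R) : `|h *: delta_mx 0 i : 'rV[R]_n| <= `|h|.
Proof.
apply: norm_rV_le => // j; rewrite !mxE eqxx normrM ler_piMr//.
by case: eqP; rewrite ?normr1 ?normr0.
Qed.

Lemma smooth_scale n (a : R) (g : 'rV[R]_n -> R) : smooth g ->
  smooth (fun x => a * g x).
Proof.
move=> gs; apply: smooth_expr_smooth; apply: SmoothMul; first exact: SmoothCst.
exact: smooth_smooth_expr.
Qed.

Lemma partial_lin n (a : R) (g h : 'rV[R]_n -> R) i : smooth g -> smooth h ->
  partial i (fun x => a * g x + h x) = fun x => a * partial i g x + partial i h x.
Proof.
move=> gs hs; apply/funext => x.
rewrite (partial_add _ _ (smooth_scale a gs) hs); congr (_ + _).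
exact: partial_scale.
Qed.

(** The mean value theorem in direction [i] for the increment of [g] in
    direction [j], and then in direction [j] for the derivative of [g] in
    direction [i]. *)
Lemma second_difference n (g : 'rV[R]_n -> R) (i j : 'I_n) (x : 'rV[R]_n) (h : R) :
  smooth g -> 0 <= h ->
  exists y, `|y - x| <= 2 * h /\
    g (x + h *: delta_mx 0 i + h *: delta_mx 0 j) - g (x + h *: delta_mx 0 i)
     - (g (x + h *: delta_mx 0 j) - g x) = h ^+ 2 * partial j (partial i g) y.
Proof.
move=> gs h0.
pose ei : 'rV[R]_n := h *: delta_mx 0 i.
pose ej : 'rV[R]_n := h *: delta_mx 0 j.
(* Written with a scaling so as to be an instance of [smooth_expr_affine]. *)
pose G x := g (1 *: x + ej) + - 1 * g x.
have Gs : smooth G.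
  apply: smooth_expr_smooth; apply: SmoothAdd; first exact: smooth_expr_affine.
  by apply: SmoothMul; [exact: SmoothCst|exact: smooth_smooth_expr].
have [c /andP[c0 c1]] := mean_value x ei (fun y => smooth_differentiable y Gs).
rewrite sum_delta => E.
pose z := x + c *: ei.
have E2 : partial i G z = partial i g (z + ej) - partial i g z.
  rewrite /G partial_add//; last 2 first.
  - by apply: smooth_expr_smooth; exact: smooth_expr_affine.
  - exact: smooth_scale.
  by rewrite partial_affine// partial_scale// scale1r mul1r mulN1r.
have [d /andP[d0 d1]] := mean_value z ej
  (fun y => smooth_differentiable y (smooth_partial i gs)).
rewrite -E2 sum_delta => E3.
exists (z + d *: ej); split.
  rewrite /z -[x + _ + _]addrA [x + _]addrC addrK.
  apply: (le_trans (ler_normD _ _)).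
  have H (b : R) k : 0 <= b -> b <= 1 ->
    `|b *: (h *: delta_mx 0 k : 'rV[R]_n)| <= h.
    move=> b0 b1; rewrite scalerA (le_trans (norm_delta_le _ _))//.
    by rewrite normrM !ger0_norm// ler_piMl.
  by have := H c i c0 c1; have := H d j d0 d1; rewrite -/ei -/ej; lra.
by rewrite expr2 -mulrA -E3 -E /G !scale1r !mulN1r.
Qed.

(** Schwarz's theorem: the second difference of [g] is symmetric in the two
    directions and approximates both mixed derivatives. *)
Lemma partial_commute n (g : 'rV[R]_n -> R) (i j : 'I_n) : real_test g ->
  partial i (partial j g) = partial j (partial i g).
Proof.
move=> gt; apply/funext => x; apply/eqP; rewrite -subr_eq0; apply/eqP.
have [L1 [L10 H1]] := real_test_lipschitz (real_test_partial i
  (real_test_partial j gt)).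
have [L2 [L20 H2]] := real_test_lipschitz (real_test_partial j
  (real_test_partial i gt)).
apply: (@eq0_of_le_linear _ (2 * (L1 + L2))) => h h0 _.
have [y [yx Ey]] := second_difference j i x gt.1 (ltW h0).
have [z [zx Ez]] := second_difference i j x gt.1 (ltW h0).
have E : partial i (partial j g) y = partial j (partial i g) z.
  have hh : h ^+ 2 != 0 by rewrite expf_neq0// gt_eqF.
  move: Ey Ez; move: (partial i (partial j g) y) (partial j (partial i g) z) =>
    p q Ey Ez.
  apply: (mulfI hh); apply: (etrans (esym Ey)); apply: etrans Ez.
  rewrite -[x + _ + _]addrA [_ *: _ + _ *: _]addrC addrA.
  by move: (g (x + _ + _)) (g (x + h *: delta_mx 0 i))
    (g (x + h *: delta_mx 0 j)) (g x) => *; ring.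
move: (H1 x y) (H2 z x); rewrite E [`|x - y|]distrC.
move: (partial i (partial j g) x) (partial j (partial i g) z) (partial j
  (partial i g) x) => p q r A1 A2.
have A3 := ler_wpM2l L10 yx; have A4 := ler_wpM2l L20 zx.
move: A1 A2 A3 A4; clear; move: `|y - x| `|z - x| => a b A1 A2 A3 A4.
have -> : p - r = (p - q) + (q - r) by ring.
by rewrite (le_trans (ler_normD _ _))//; lra.
Qed.

Lemma partials_partial n (g : 'rV[R]_n -> R) (i : 'I_n) s : real_test g ->
  partials s (partial i g) = partial i (partials s g).
Proof.
move=> gt; elim: s => [//|j s IH].
rewrite !partials_cons IH; apply: partial_commute; exact: real_test_partials.
Qed.

Lemma smooth_lin n (a : R) (g h : 'rV[R]_n -> R) : smooth g -> smooth h ->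
  smooth (fun x => a * g x + h x).
Proof.
move=> gs hs; apply: smooth_expr_smooth; apply: SmoothAdd;
  last exact: smooth_smooth_expr.
by apply: SmoothMul; [exact: SmoothCst|exact: smooth_smooth_expr].
Qed.

Lemma partials_lin n (a : R) (g h : 'rV[R]_n -> R) s : smooth g -> smooth h ->
  partials s (fun x => a * g x + h x) = fun x =>
    a * partials s g x + partials s h x.
Proof.
move=> gs hs; elim: s => [//|i s IH].
by rewrite partials_cons IH partial_lin//; exact: smooth_partials.
Qed.

Lemma real_test_lin n (a : R) (g h : 'rV[R]_n -> R) : real_test g -> real_test h ->
  real_test (fun x => a * g x + h x).
Proof.
move=> gt ht; split; first by apply: smooth_lin; [case: gt|case: ht].
have [M [M0 gM]] := real_test_radius gt; have [N [N0 hN]] := real_test_radius ht.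
by exists (M + N) => x Mx; rewrite gM ?hN ?mulr0 ?addr0//; apply: le_lt_trans Mx;
  rewrite ?lerDl ?lerDr.
Qed.

Lemma real_test0 n : real_test (fun _ : 'rV[R]_n => 0 : R).
Proof.
split; last by exists 0.
by apply: smooth_expr_smooth; exact: SmoothCst.
Qed.

Lemma real_test_scale n (a : R) (g : 'rV[R]_n -> R) : real_test g ->
    real_test (fun x => a * g x).
Proof.
move=> gt; have := real_test_lin a gt (real_test0 n).
by congr real_test; apply/funext => x; rewrite addr0.
Qed.

Lemma real_test_mull n (h g : 'rV[R]_n -> R) : smooth_expr h -> real_test g ->
  real_test (fun x => h x * g x).
Proof.
move=> hs [gs [M gM]]; split.
  by apply: smooth_expr_smooth; apply: SmoothMul => //; exact: smooth_smooth_expr.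
by exists M => x Mx; rewrite gM// mulr0.
Qed.

Lemma vanishes_affine n (g : 'rV[R]_n -> R) (a : R) (b : 'rV[R]_n) : real_test g ->
  a != 0 -> exists M, vanishes_beyond M (fun x => g (a *: x + b)).
Proof.
move=> gt a0.
by have [M [L [_ _ H _]]] := clipschitz_affine b (real_test_clipschitz gt) a0;
  exists M.
Qed.

Lemma real_test_affine n (g : 'rV[R]_n -> R) (a : R) (b : 'rV[R]_n) : real_test g ->
  a != 0 -> real_test (fun x => g (a *: x + b)).
Proof.
move=> gt a0; split; last exact: vanishes_affine.
by apply: smooth_expr_smooth; apply: smooth_expr_affine; case: gt.
Qed.

End Test.

(** * Smearing a test function by another *)

Section Smear.
Variable R : realType.
Local Open Scope classical_set_scope.

Lemma le_of_eq (x y : R) : x = y -> x <= y.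
Proof. by move=> ->. Qed.

Lemma clipschitz_ext (V : normedModType R) (g h : V -> R) : clipschitz g ->
    g =1 h -> clipschitz h.
Proof. by move=> gl gh; have <- : g = h by apply/funext. Qed.

Lemma clipschitz_scale (V : normedModType R) (a : R) (g : V -> R) :
  clipschitz g -> clipschitz (fun x => a * g x).
Proof.
by move=> gl; apply: (clipschitz_ext (clipschitz_lin a gl (clipschitz0 V))) =>
  x; rewrite addr0.
Qed.

Lemma integral_rV_scale n (a : R) (g : 'rV[R]_n -> R) : clipschitz g ->
  integral_rV (fun x => a * g x) = a * integral_rV g.
Proof.
move=> gl; have := integral_rV_lin a gl (clipschitz_scale 0 gl).
have -> : (fun x => a * g x + 0 * g x) = (fun x => a * g x).
  by apply/funext => x; rewrite mul0r addr0.
have := integral_rV_lin (-1) (clipschitz_scale 0 gl) (clipschitz_scale 0 gl).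
have -> : (fun x => -1 * (0 * g x) + 0 * g x) = (fun x => 0 * g x).
  by apply/funext => x; rewrite !mul0r mulr0 addr0.
by move=> ->; rewrite mulN1r addNr addr0.
Qed.

Lemma integral_rV0 n : integral_rV (fun _ : 'rV[R]_n => 0 : R) = 0.
Proof.
rewrite -[RHS](mul0r (integral_rV (fun _ : 'rV[R]_n => 0 : R))).
rewrite -integral_rV_scale; last exact: clipschitz0.
by congr integral_rV; apply/funext => x; rewrite mul0r.
Qed.

Lemma clipschitz_sum (V : normedModType R) p (c : 'I_p -> R) (k : 'I_p -> V -> R)
    (s : seq 'I_p) : (forall j, clipschitz (k j)) ->
  clipschitz (fun x => \sum_(j <- s) c j * k j x).
Proof.
move=> kl; elim: s => [|j s IH].
  by apply: (clipschitz_ext (clipschitz0 V)) => x; rewrite big_nil.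
by apply: (clipschitz_ext (clipschitz_lin (c j) (kl j) IH)) => x; rewrite big_cons.
Qed.

Lemma integral_rV_sum n p (c : 'I_p -> R) (k : 'I_p -> 'rV[R]_n -> R)
    (s : seq 'I_p) : (forall j, clipschitz (k j)) ->
  integral_rV (fun x => \sum_(j <- s) c j * k j x) =
  \sum_(j <- s) c j * integral_rV (k j).
Proof.
move=> kl; elim: s => [|j s IH].
  under eq_fun do rewrite big_nil.
  by rewrite integral_rV0 big_nil.
under eq_fun do rewrite big_cons.
by rewrite integral_rV_lin ?IH ?big_cons//; exact: clipschitz_sum.
Qed.

Lemma clipschitz_comb (V : normedModType R) p (g h : V -> R) (c : 'I_p -> R)
    (k : 'I_p -> V -> R) : clipschitz g -> clipschitz h ->
      (forall j, clipschitz (k j)) ->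
  clipschitz (fun x => g x - h x - \sum_j c j * k j x).
Proof.
move=> gl hl kl.
apply: (clipschitz_ext (clipschitz_lin (-1) (clipschitz_sum c (index_enum _)
  kl) (clipschitz_lin (-1) hl gl))).
by move=> x; rewrite !mulN1r; ring.
Qed.

Lemma integral_rV_comb n p (g h : 'rV[R]_n -> R) (c : 'I_p -> R)
    (k : 'I_p -> 'rV[R]_n -> R) : clipschitz g -> clipschitz h ->
      (forall j, clipschitz (k j)) ->
  integral_rV g - integral_rV h - \sum_j c j * integral_rV (k j) =
  integral_rV (fun x => g x - h x - \sum_j c j * k j x).
Proof.
move=> gl hl kl.
have -> : (fun x => g x - h x - \sum_j c j * k j x) =
    (fun x => -1 * (\sum_j c j * k j x) + (-1 * h x + g x)).
  by apply/funext => x; ring.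
rewrite integral_rV_lin; last 2 first.
- exact: clipschitz_sum.
- exact: clipschitz_lin.
by rewrite integral_rV_lin// integral_rV_sum//; ring.
Qed.

(** For [t != 0] this is the convolution of [phi] with the dilation of [psi] by
    [t], normalized to keep its mass; at [t = 0] it degenerates to [phi] times
    the integral of [psi]. As a function of [t] it passes smoothly through
    [0], which is why it is preferred to convolution. *)
Definition smear n (phi psi : 'rV[R]_n -> R) (t : R) (u : 'rV[R]_n) : R :=
  integral_rV (fun y => phi (u - t *: y) * psi y).

Lemma smear_clipschitz n (phi psi : 'rV[R]_n -> R) t u : real_test phi ->
    clipschitz psi ->
  clipschitz (fun y => phi (u - t *: y) * psi y).
Proof.
move=> ft pl; have [L [L0 fL]] := real_test_lipschitz ft.
have [B [B0 fB]] := real_test_bounded ft.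
apply: (@clipschitzM _ _ _ _ (L * `|t|) B) => // x y.
apply: (le_trans (fL _ _)).
rewrite opprD addrACA subrr add0r -mulrA ler_wpM2l// -normrZ.
by rewrite scalerBr -opprB normrN opprK addrC.
Qed.

(** The increment [h y] may depend on the variable of integration: a constant
    increment gives the derivative of [smear phi psi t] in space, and an
    increment proportional to [y] gives its derivative in [t]. *)
Lemma integral_taylor2 n p (phi psi : 'rV[R]_n -> R) (x h : 'rV[R]_n -> 'rV[R]_n)
    (B D M H : R) (c : 'I_p -> R) (g1 g2 : 'rV[R]_n -> R)
    (k : 'I_p -> 'rV[R]_n -> R) :
  smooth phi -> 0 <= B -> (forall i j y, `|partial i (partial j phi) y| <= B) ->
  0 <= M -> vanishes_beyond M psi -> (forall y, `|psi y| <= D) ->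
  (forall y, `|y| <= M -> `|h y| <= H) ->
  clipschitz g1 -> clipschitz g2 -> (forall j, clipschitz (k j)) ->
  (forall y, g1 y = phi (x y + h y) * psi y) ->
  (forall y, g2 y = phi (x y) * psi y) ->
  (forall y, \sum_j c j * k j y = (\sum_j h y 0 j * partial j phi (x y)) * psi y) ->
  `|integral_rV g1 - integral_rV g2 - \sum_j c j * integral_rV (k j)| <=
  n%:R ^+ 2 * B * H ^+ 2 * D * (2 * M) ^+ n.
Proof.
move=> fs B0 fB M0 pM pD hH g1l g2l kl E1 E2 E3.
rewrite integral_rV_comb//.
have E y : g1 y - g2 y - \sum_j c j * k j y =
    (phi (x y + h y) - phi (x y) - \sum_j h y 0 j * partial j phi (x y)) * psi y.
  by rewrite E1 E2 E3 !mulrBl.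
have H0 : 0 <= H by apply: le_trans (hH 0 _); rewrite ?normr0.
have D0 : 0 <= D by apply: le_trans (pD 0).
apply: integral_rV_bound => //; first exact: clipschitz_comb.
  by move=> y My; rewrite E pM// mulr0.
move=> y; rewrite E normrM; have [yM|My] := leP `|y| M; last first.
  by rewrite pM// normr0 mulr0 !mulr_ge0// exprn_ge0.
apply: ler_pM => //; apply: (le_trans (taylor2_le _ _ fs B0 fB)).
rewrite ler_wpM2l ?mulr_ge0 ?exprn_ge0//.
by rewrite lerXn2r ?nnegrE// hH.
Qed.

Lemma smear_quadratic n (phi psi : 'rV[R]_n -> R) t u : real_test phi ->
    real_test psi ->
  exists C : R, forall h, `|smear phi psi t (u + h) - smear phi psi t u
    - \sum_j h 0 j * smear (partial j phi) psi t u| <= C * `|h| ^+ 2.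
Proof.
move=> ft pt; have [B [B0 fB]] := real_test_bounded_partials 2 ft.
have [D [D0 pD]] := real_test_bounded pt; have [M [M0 pM]] := real_test_radius pt.
exists (n%:R ^+ 2 * B * D * (2 * M) ^+ n) => h.
have pl := real_test_clipschitz pt.
have := @integral_taylor2 n n phi psi (fun y => u - t *: y) (fun=> h) B D M `|h|
  (fun j => h 0 j) _ _ (fun j y => partial j phi (u - t *: y) * psi y)
  (real_test_smooth ft) B0 (fun i j y =>
    fB [:: i; j] y isT) M0 pM pD (fun _ _ => lexx _)
  (smear_clipschitz t (u + h) ft pl) (smear_clipschitz t u ft pl)
  (fun j => smear_clipschitz t u (real_test_partial j ft) pl).
have -> : n%:R ^+ 2 * B * `|h| ^+ 2 * D * (2 * M) ^+ n =
  n%:R ^+ 2 * B * D * (2 * M) ^+ n * `|h| ^+ 2 by ring.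
apply => // y; first by rewrite addrAC.
by rewrite mulr_suml; apply: eq_bigr => j _; rewrite mulrA.
Qed.

Lemma smear_partial n (phi psi : 'rV[R]_n -> R) t i : real_test phi ->
    real_test psi ->
  partial i (smear phi psi t) = smear (partial i phi) psi t.
Proof.
move=> ft pt; apply/funext => u; have [C HC] := smear_quadratic t u ft pt.
exact: (differentiable_of_quadratic HC).2.
Qed.

Lemma smear_partials n (phi psi : 'rV[R]_n -> R) t s : real_test phi ->
    real_test psi ->
  partials s (smear phi psi t) = smear (partials s phi) psi t.
Proof.
move=> ft pt; elim: s => [//|i s IH].
by rewrite partials_cons IH smear_partial//; exact: real_test_partials.
Qed.

Lemma smear_vanishes n (phi psi : 'rV[R]_n -> R) (t M N T : R) :
  vanishes_beyond M phi -> vanishes_beyond N psi -> 0 <= N -> `|t| <= T ->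
  vanishes_beyond (M + T * N) (smear phi psi t).
Proof.
move=> fM pN N0 tT u Mu.
have E : (fun y => phi (u - t *: y) * psi y) = (fun=> 0).
  apply/funext => y; have [yN|Ny] := leP `|y| N; last first.
    by rewrite pN// mulr0.
  rewrite fM ?mul0r//.
  have : `|u| <= `|u - t *: y| + `|t *: y|.
    by rewrite -{1}(subrK (t *: y) u) ler_normD.
  have : `|t *: y| <= T * N by rewrite normrZ ler_pM.
  by lra.
by rewrite /smear E integral_rV0.
Qed.

Lemma smear_real_test n (phi psi : 'rV[R]_n -> R) t : real_test phi ->
    real_test psi ->
  real_test (smear phi psi t).
Proof.
move=> ft pt; split.
  move=> s u; rewrite smear_partials//.
  have [C HC] := smear_quadratic t u (real_test_partials s ft) pt.
  exact: (differentiable_of_quadratic HC).1.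
have [M [M0 fM]] := real_test_radius ft; have [N [N0 pN]] := real_test_radius pt.
by exists (M + `|t| * N); exact: smear_vanishes.
Qed.

Lemma real_test_coord n (psi : 'rV[R]_n -> R) j : real_test psi ->
  real_test (fun y => y 0 j * psi y).
Proof. by apply: real_test_mull; exact: SmoothCoord. Qed.

Lemma smear0 n (phi psi : 'rV[R]_n -> R) u : real_test psi ->
  smear phi psi 0 u = phi u * integral_rV psi.
Proof.
move=> pt; rewrite /smear -integral_rV_scale; last exact: real_test_clipschitz.
by congr integral_rV; apply/funext => y; rewrite scale0r subr0.
Qed.

(** The derivative of [phi (u - t *: y)] in [t] is minus the sum of the
    [y_j * partial j phi (u - t *: y)]; the factor [y_j] is absorbed by
    [psi]. *)
Lemma smear_time_quadratic n (chi psi : 'rV[R]_n -> R) (B D M t h : R) u :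
  real_test chi -> real_test psi -> 0 <= B ->
  (forall i j y, `|partial i (partial j chi) y| <= B) ->
  0 <= M -> vanishes_beyond M psi -> (forall y, `|psi y| <= D) ->
  `|smear chi psi (t + h) u - smear chi psi t u
     + h * \sum_j smear (partial j chi) (fun y => y 0 j * psi y) t u| <=
  n%:R ^+ 2 * B * (M * `|h|) ^+ 2 * D * (2 * M) ^+ n.
Proof.
move=> ct pt B0 cB M0 pM pD; have pl := real_test_clipschitz pt.
have := @integral_taylor2 n n chi psi (fun y => u - t *: y) (fun y => - (h *: y))
  B D M (M * `|h|) (fun=> - h) _ _
  (fun j y => partial j chi (u - t *: y) * (y 0 j * psi y))
  (real_test_smooth ct) B0 cB M0 pM pD _
  (smear_clipschitz (t + h) u ct pl) (smear_clipschitz t u ct pl)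
  (fun j => smear_clipschitz t u (real_test_partial j ct) (real_test_clipschitz
    (real_test_coord j pt))).
rewrite -mulr_sumr mulNr opprK; apply => y.
- by move=> yM; rewrite normrN normrZ mulrC ler_wpM2r.
- by rewrite scalerDl opprD addrA.
- by [].
- rewrite mulr_suml; apply: eq_bigr => j _; rewrite !mxE.
  by move: (partial j chi _) (psi y) (y 0 j) => a b c; ring.
Qed.

Lemma smear_dilate n (phi psi : 'rV[R]_n -> R) (t s : R) : real_test phi ->
    real_test psi ->
  0 < s ->
  smear phi (fun y => psi (s^-1 *: y + 0)) t = fun u =>
    s ^+ n * smear phi psi (t * s) u.
Proof.
move=> ft pt s0; apply/funext => u.
have s1 : s^-1 != 0 by rewrite invr_eq0 gt_eqF.
have := integral_rV_affine (0 : 'rV[R]_n) (smear_clipschitz (t * s) u ft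
  (real_test_clipschitz pt)) s1.
rewrite normfV gtr0_norm// exprVn invrK -/(smear phi psi (t * s) u) => <-.
congr integral_rV; apply/funext => y; congr (phi (u - _) * _).
by rewrite addr0 scalerA mulfK ?gt_eqF.
Qed.

(** Commutativity of convolution: after a change of variables the integration is
    against [phi] instead of [psi]. *)
Lemma smear_swap n (phi psi : 'rV[R]_n -> R) (t : R) : real_test phi ->
    real_test psi ->
  t != 0 -> smear phi psi t =
    fun u => (`|t| ^+ n)^-1 * smear (fun y => psi (t^-1 *: y + 0)) phi 1 u.
Proof.
move=> ft pt t0; apply/funext => u.
have t1 : t^-1 != 0 by rewrite invr_eq0.
have Nt0 : - t != 0 by rewrite oppr_eq0.
have := integral_rV_affine u (smear_clipschitz 1 u (real_test_affine 0 pt t1)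
  (real_test_clipschitz ft)) Nt0.
rewrite normrN -/(smear _ _ 1 u) => <-.
congr integral_rV; apply/funext => y; rewrite mulrC.
have E : u - t *: y = - t *: y + u by rewrite scaleNr addrC.
congr (psi _ * _); last by rewrite E.
by rewrite scale1r addr0 -E opprB addrC subrK scalerA mulVf// scale1r.
Qed.

(** The integral is invariant under translations, while the increment of [g] in
    direction [j] is, up to a quadratic error, proportional to its partial
    derivative. *)
Lemma integral_partial n (g : 'rV[R]_n -> R) j : real_test g ->
    integral_rV (partial j g) = 0.
Proof.
move=> gt; have gl := real_test_clipschitz gt.
have [B [B0 fB]] := real_test_bounded_partials 2 gt.
have [M [M0 gM]] := real_test_radius gt.
apply: (@eq0_of_le_linear _ _ (n%:R ^+ 2 * B * (2 * (M + 1)) ^+ n)) => h h0 h1.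
pose e : 'rV[R]_n := h *: delta_mx 0 j.
have tl : clipschitz (fun y => g (1 *: y + e))
  by apply: clipschitz_affine => //; exact: oner_neq0.
have E := integral_rV_comb (fun k => e 0 k) tl gl (fun k =>
  real_test_clipschitz (real_test_partial k gt)).
have T := integral_rV_affine e gl (oner_neq0 _).
rewrite T normr1 expr1n invr1 mul1r subrr sub0r sum_delta in E.
have : `|- (h * integral_rV (partial j g))| <= n%:R ^+ 2 * B * h ^+ 2 *
    (2 * (M + 1)) ^+ n.
  rewrite E; apply: integral_rV_bound.
  - apply: clipschitz_comb => // k; exact: real_test_clipschitz
    (real_test_partial k gt).
  - move=> y My.
    have yM : M < `|y| by lra.
    rewrite gM; last first.
      have : `|y| <= `|1 *: y + e| + `|e|.
        by rewrite -{1}(addrK e y) scale1r ler_normB.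
      by have := norm_delta_le j h; rewrite -/e (ger0_norm (ltW h0)); lra.
    rewrite gM// subr0 sub0r big1 ?oppr0// => k _.
    by rewrite (partial_vanishes _ gM)// mulr0.
  - by rewrite addr_ge0.
  - move=> y; rewrite scale1r.
    apply: (le_trans (taylor2_le _ _ (real_test_smooth gt) B0 (fun i j y =>
      fB [:: i; j] y isT))).
    rewrite ler_wpM2l ?mulr_ge0 ?exprn_ge0//.
    have := norm_delta_le j h; rewrite -/e (ger0_norm (ltW h0)) => eh.
    by rewrite lerXn2r ?nnegrE// ltW.
rewrite normrN normrM gtr0_norm// => H.
rewrite -(ler_pM2l h0); apply: (le_trans H).
by apply: le_of_eq; ring.
Qed.

(** Integration by parts in [y]: the factor [t] comes out of
    [phi (u - t *: y)]. It is this factor that isolates the derivatives of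
    order [m] in [difference_eq_kills]. *)
Lemma smear_by_parts n (phi psi : 'rV[R]_n -> R) t j : real_test phi ->
    real_test psi ->
  smear phi (partial j psi) t = fun u => t * smear (partial j phi) psi t u.
Proof.
move=> ft pt; apply/funext => u.
have fe : smooth_expr (fun y => phi (- t *: y + u)).
  by apply: smooth_expr_affine; case: ft.
have gt := real_test_mull fe pt.
have := integral_partial j gt.
have -> : partial j (fun x => phi (- t *: x + u) * psi x) =
  fun y => - t * (partial j phi (u - t *: y) * psi y) + phi (u - t *: y) *
    partial j psi y.
  apply/funext => y; rewrite partial_mul; last 2 first.
  - exact: smooth_expr_smooth.
  - exact: real_test_smooth.
  rewrite partial_affine; last exact: real_test_smooth.
  by rewrite scaleNr addrC [- _ + u]addrC; ring.
rewrite integral_rV_lin; last 2 first.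
- apply: smear_clipschitz; [exact: real_test_partial|exact: real_test_clipschitz].
- apply: smear_clipschitz => //; apply: real_test_clipschitz;
  exact: real_test_partial.
by rewrite -/(smear _ _ t u) -/(smear _ _ t u) mulNr => /eqP;
  rewrite addrC subr_eq0 => /eqP.
Qed.

End Smear.

(** * Real distributions *)

Section Func.
Variable R : realType.
Local Open Scope classical_set_scope.

(** The continuity estimate speaks of an arbitrary bound [B] instead of the
    supremum of the derivatives, so that no supremum has to be computed. *)
Definition real_dist n (F : ('rV[R]_n -> R) -> R) :=
  (forall a phi psi, real_test phi -> real_test psi ->
     F (fun x => a * phi x + psi x) = a * F phi + F psi) /\
  (forall M : R, exists (C : R) (N : nat), forall phi (B : R), real_test phi ->
     vanishes_beyond M phi ->
     (forall s x, (size s <= N)%N -> `|partials s phi x| <= B) ->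
       `|F phi| <= C * B).

Section Linear.
Variables (n : nat) (F : ('rV[R]_n -> R) -> R).
Hypothesis Fd : real_dist F.

Lemma real_dist0 : F (fun=> 0) = 0.
Proof.
have := Fd.1 (-1) _ _ (real_test0 R n) (real_test0 R n).
have -> : (fun _ : 'rV[R]_n => -1 * 0 + 0) = (fun=> 0 : R).
  by apply/funext => x; rewrite mulr0 addr0.
by rewrite mulN1r addNr.
Qed.

Lemma real_dist_scale a phi : real_test phi -> F (fun x => a * phi x) = a * F phi.
Proof.
move=> ft; have := Fd.1 a _ _ ft (real_test0 R n); rewrite real_dist0 addr0 => <-.
by congr F; apply/funext => x; rewrite addr0.
Qed.

Lemma real_test_sum p (k : 'I_p -> 'rV[R]_n -> R) (s : seq 'I_p) :
  (forall j, real_test (k j)) -> real_test (fun x => \sum_(j <- s) k j x).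
Proof.
move=> kt; elim: s => [|j s IH].
  by under eq_fun do rewrite big_nil; exact: real_test0.
have := real_test_lin 1 (kt j) IH; congr real_test; apply/funext => x.
by rewrite big_cons mul1r.
Qed.

Lemma real_dist_sum p (k : 'I_p -> 'rV[R]_n -> R) (s : seq 'I_p) :
  (forall j, real_test (k j)) -> F (fun x =>
    \sum_(j <- s) k j x) = \sum_(j <- s) F (k j).
Proof.
move=> kt; elim: s => [|j s IH].
  by under eq_fun do rewrite big_nil; rewrite big_nil real_dist0.
rewrite big_cons -IH -[F (k j)]mul1r -Fd.1//; last exact: real_test_sum.
by congr F; apply/funext => x; rewrite big_cons mul1r.
Qed.

Lemma partials_sum p (k : 'I_p -> 'rV[R]_n -> R) (r : seq 'I_p) s :
  (forall j, real_test (k j)) ->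
  partials s (fun x => \sum_(j <- r) k j x) = fun x =>
    \sum_(j <- r) partials s (k j) x.
Proof.
move=> kt; elim: r => [|j r IH].
  under eq_fun do rewrite big_nil.
  by rewrite partials0; apply/funext => x; rewrite big_nil.
have -> : (fun x => \sum_(j <- j :: r) k j x) =
    (fun x => 1 * k j x + \sum_(j <- r) k j x).
  by apply/funext => x; rewrite big_cons mul1r.
rewrite partials_lin ?IH; last 2 first.
- exact: real_test_smooth.
- by apply: real_test_smooth; exact: real_test_sum.
by apply/funext => x; rewrite big_cons mul1r.
Qed.

(** Continuity of [F] turns the estimate of [smear_time_quadratic], which holds
    for all the derivatives of [phi] with a common constant, into the
    differentiability in [t] of [F (smear phi psi t)]. *)
Lemma real_dist_time_quadratic phi psi (T : R) : real_test phi -> real_test psi ->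
  exists C : R, forall t h, `|t| <= T -> `|h| <= 1 ->
   `|F (smear phi psi (t + h)) - F (smear phi psi t) +
     h * \sum_j F (smear (partial j phi) (fun y => y 0 j * psi y) t)| <= C * h ^+ 2.
Proof.
move=> ft pt; have [M [M0 fM]] := real_test_radius ft.
have [P [P0 pP]] := real_test_radius pt; have [D [D0 pD]] := real_test_bounded pt.
have [C [N HF]] := Fd.2 (M + (T + 1) * P).
have [B [B0 fB]] := real_test_bounded_partials (N + 2) ft.
exists (C * (n%:R ^+ 2 * B * P ^+ 2 * D * (2 * P) ^+ n)) => t h tT h1.
pose Kj j := smear (partial j phi) (fun y => y 0 j * psi y) t.
have Kjt j : real_test (Kj j) by apply: smear_real_test;
  [exact: real_test_partial|exact: real_test_coord].
have St : real_test (fun u => \sum_j Kj j u) by exact: real_test_sum.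
have K1t := smear_real_test (t + h) ft pt; have K0t := smear_real_test t ft pt.
(* [W] is the remainder of the first order expansion in [t]; all its
   derivatives are remainders of the same kind. *)
pose W u := h * (\sum_j Kj j u) + (-1 * smear phi psi t u + smear phi psi (t +
  h) u).
have Wt : real_test W by apply: real_test_lin => //; exact: real_test_lin.
have -> : F (smear phi psi (t + h)) - F (smear phi psi t) + h * (\sum_j F (Kj
  j)) = F W.
  rewrite /W Fd.1//; last exact: real_test_lin.
  rewrite Fd.1// real_dist_sum// mulN1r.
  by move: (F _) (F _) (\sum_j _) => *; ring.
have -> : C * (n%:R ^+ 2 * B * P ^+ 2 * D * (2 * P) ^+ n) * h ^+ 2 =
    C * (n%:R ^+ 2 * B * (P * `|h|) ^+ 2 * D * (2 * P) ^+ n).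
  by rewrite exprMn -[h ^+ 2]real_normK ?num_real//; ring.
apply: HF => //.
  have tT1 : `|t| <= T + 1 by rewrite (le_trans tT)// lerDl.
  have thT1 : `|t + h| <= T + 1 by rewrite (le_trans (ler_normD _ _))// lerD.
  move=> u Mu.
  rewrite /W (smear_vanishes fM pP P0 tT1)// (smear_vanishes fM pP P0 thT1)//.
  rewrite big1 ?mulr0 ?addr0// => j _.
  apply: (smear_vanishes (partial_vanishes j fM) _ P0 tT1) => // y Py.
  by rewrite pP// mulr0.
move=> s u sN.
rewrite /W partials_lin; last 2 first.
- exact: real_test_smooth.
- by apply: real_test_smooth; exact: real_test_lin.
rewrite partials_lin; last 2 first.
- exact: real_test_smooth.
- exact: real_test_smooth.
rewrite partials_sum// !smear_partials//.
have E : \sum_j partials s (Kj j) u =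
    \sum_j smear (partial j (partials s phi)) (fun y => y 0 j * psi y) t u.
  apply: eq_bigr => j _; rewrite /Kj smear_partials; last 2 first.
  - exact: real_test_partial.
  - exact: real_test_coord.
  by rewrite partials_partial.
rewrite E.
have := @smear_time_quadratic R n (partials s phi) psi B D P t h u
  (real_test_partials s ft) pt B0 _ P0 pP pD.
rewrite mulN1r [h * _ + _]addrC [- _ + _]addrC; apply => i j y.
rewrite -!partials_cons; apply: fB => /=.
by rewrite addn2 !ltnS.
Qed.

End Linear.

Section Taylor1D.

Lemma is_derive_of_quadratic (u : R -> R) (t a C : R) :
  (forall h, `|h| <= 1 -> `|u (t + h) - u t - h * a| <= C * h ^+ 2) ->
  is_derive t (1 : R) u a.
Proof.
move=> H.
have L : h^-1 *: ((u \o shift t) (h *: (1 : R)) - u t) @[h --> (0 : R)^'] --> a.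
  apply/cvgrPdist_le => e e0.
  have C1 : 0 < `|C| + 1 by rewrite ltr_wpDl.
  near=> h.
  have h0 : h != 0 by near: h; exact: nbhs_dnbhs_neq.
  have h1 : `|h| <= 1 by near: h; exact: dnbhs0_le.
  have he : `|h| <= e / (`|C| + 1) by near: h; apply: dnbhs0_le; rewrite divr_gt0.
  have h0' : 0 < `|h| by rewrite normr_gt0.
  rewrite -(ler_pM2l h0') -normrM mulrBr [h *: 1]mulr1 /=.
  have -> : h * (h^-1 *: (u (h + t) - u t)) = u (h + t) - u t by exact: mulVKf.
  rewrite distrC [h + t]addrC; apply: (le_trans (H h h1)).
  rewrite -real_normK ?num_real// expr2 mulrCA ler_wpM2l//.
  apply: (@le_trans _ _ ((`|C| + 1) * `|h|)).
    by rewrite ler_wpM2r// (le_trans (ler_norm _))// lerDl.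
  by rewrite mulrC -ler_pdivlMr.
split; first by apply/cvg_ex; exists a.
exact: cvg_lim L.
Unshelve. all: by end_near. Qed.

(** Taylor's formula without remainder: by induction, both sides have the same
    derivative, and they agree at [0]. *)
Lemma taylor_vanishing (m : nat) (a : nat -> R -> R) :
  (forall k t, is_derive t (1 : R) (a k) (a k.+1 t)) -> (forall t, a m t = 0) ->
  forall t, a 0 t = \sum_(k < m) t ^+ k / k`!%:R * a k 0.
Proof.
elim: m a => [|m IH] a da am0 t; first by rewrite big_ord0 am0.
have {}IH := IH (fun k => a k.+1) (fun k t => da k.+1 t) am0.
pose P (s : R) := \sum_(k < m) s ^+ k.+1 / k.+1`!%:R * a k.+1 0.
have dP (s : R) : is_derive s (1 : R) P (a 1 s).
  rewrite IH /P.
  have -> : (fun s : R => \sum_(k < m) s ^+ k.+1 / k.+1`!%:R * a k.+1 0) =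
      \sum_(k < m) (fun s : R => s ^+ k.+1 / k.+1`!%:R * a k.+1 0).
    by apply/funext => x; rewrite fct_sumE.
  apply: is_derive_sum => k.
  have -> : (fun s : R => s ^+ k.+1 / k.+1`!%:R * a k.+1 0) =
      (k.+1`!%:R^-1 * a k.+1 0) \*: ((@id R) ^+ k.+1).
    by apply/funext => x; rewrite /= -mulrA mulrC exprfctE.
  apply: is_derive_eq.
  rewrite factS natrM invfM.
  have : k.+1%:R != 0 :> R by rewrite pnatr_eq0.
  have : k`!%:R != 0 :> R by rewrite pnatr_eq0 -lt0n fact_gt0.
  rewrite [_ *: 1]mulr1 [_ *: _]mulrC /= => k0 k1.
  by move: k1 => /mulfV k1; rewrite !mulrA [_ * k.+1%:R^-1]mulrAC k1 mul1r.
have : (a 0 - P) t = (a 0 - P) 0.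
  apply: is_derive_0_is_cst => s.
  have := is_deriveB (da 0%N s) (dP s); rewrite subrr.
  by [].
rewrite !fctE => /eqP; rewrite subr_eq => /eqP ->.
rewrite big_ord_recl expr0 fact0 invr1 !mul1r.
rewrite {1}/P big1 ?subr0//; first by move=> k _; rewrite expr0n mul0r mul0r.
Qed.
End Taylor1D.

End Func.

(** * The difference equation *)

Section Diff.
Variable R : realType.
Local Open Scope classical_set_scope.

(** The [k]-th derivative in [t] of [F (smear phi psi t)], see
    [smear_deriv_derive]. *)
Fixpoint smear_deriv n (F : ('rV[R]_n -> R) -> R) (k : nat)
    (phi psi : 'rV[R]_n -> R) (t : R) : R :=
  if k is k'.+1 then
    - \sum_j smear_deriv F k' (partial j phi) (fun y => y 0 j * psi y) t
  else F (smear phi psi t).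

Lemma smear_deriv_derive n (F : ('rV[R]_n -> R) -> R) k phi psi t :
  real_dist F -> real_test phi -> real_test psi ->
  is_derive t (1 : R) (smear_deriv F k phi psi) (smear_deriv F k.+1 phi psi t).
Proof.
move=> Fd; elim: k phi psi => [|k IH] phi psi ft pt.
  have [C HC] := real_dist_time_quadratic Fd `|t| ft pt.
  apply: (@is_derive_of_quadratic _ _ _ _ C) => h h1.
  by rewrite mulrN opprK; exact: HC.
have -> : smear_deriv F k.+1 phi psi =
    - (\sum_j (fun t => smear_deriv F k (partial j phi) (fun y =>
      y 0 j * psi y) t)).
  by apply/funext => s; rewrite fctE fct_sumE.
apply: is_deriveN; apply: is_derive_sum => j; apply: IH.
  exact: real_test_partial.
exact: real_test_coord.
Qed.

Definition kills_partials n (m : nat) (F : ('rV[R]_n -> R) -> R) :=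
  forall s phi, size s = m -> real_test phi -> F (partials s phi) = 0.

(** Each step of the recursion moves one derivative to [phi]; once there are
    [m] of them they come out of [smear] and [F] kills them. *)
Lemma smear_deriv_eq0 n m (F : ('rV[R]_n -> R) -> R) k s phi psi t :
  kills_partials m F -> real_test phi -> real_test psi -> (size s + k = m)%N ->
  smear_deriv F k (partials s phi) psi t = 0.
Proof.
move=> Fk ft; elim: k s psi => [|k IH] s psi pt sk /=.
  rewrite -smear_partials// Fk//; first by rewrite -sk addn0.
  exact: smear_real_test.
rewrite big1 ?oppr0// => j _; rewrite -partials_cons IH//.
  exact: real_test_coord.
by rewrite /= addSnnS.
Qed.

(** If [F] kills the derivatives of order [m], then [F (smear phi psi t)] is a
    polynomial in [t] of degree less than [m]; this is its value at [1]. *)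
Lemma taylor_smear n m (F : ('rV[R]_n -> R) -> R) phi psi :
  real_dist F -> kills_partials m F -> real_test phi -> real_test psi ->
  F (smear phi psi 1) = \sum_(k < m) k`!%:R^-1 * smear_deriv F k phi psi 0.
Proof.
move=> Fd Fk ft pt.
have := @taylor_vanishing R m (fun k => smear_deriv F k phi psi)
  (fun k t => @smear_deriv_derive n F k phi psi t Fd ft pt)
  (fun t => @smear_deriv_eq0 n m F m [::] phi psi t Fk ft pt (add0n m)) 1.
by move=> /= ->; apply: eq_bigr => k _; rewrite expr1n mul1r.
Qed.

Import -(notations) mpoly.

Notation peval p := (fun x : 'rV[R]_(_) => mpoly.meval (fun i => x 0 i) p).

(** The real distributions defined by a polynomial of degree less than [k]
    ([mpoly.msize] is one more than the degree). *)
Definition poly_functional n (k : nat) (L : ('rV[R]_n -> R) -> R) :=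
  exists p : mpoly.mpoly n R, [/\ (mpoly.msize p <= k)%N, smooth_expr (peval p) &
    forall psi, real_test psi -> L psi = integral_rV (fun x => peval p x * psi x)].

Lemma poly_functionalW n k k' (L : ('rV[R]_n -> R) -> R) :
  (k <= k')%N -> poly_functional k L -> poly_functional k' L.
Proof. by move=> kk [p [pk ps Lp]]; exists p; split => //; exact: leq_trans kk. Qed.

Lemma poly_functional0 n k : poly_functional k (fun _ : 'rV[R]_n -> R => 0).
Proof.
exists 0; split.
- by rewrite mpoly.msize0.
- under eq_fun do rewrite mpoly.meval0; exact: SmoothCst.
- move=> psi pt; under eq_fun do rewrite mpoly.meval0 mul0r.
  by rewrite integral_rV0.
Qed.

Lemma poly_functional_lin n k a (L L' : ('rV[R]_n -> R) -> R) :
  poly_functional k L -> poly_functional k L' ->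
    poly_functional k (fun psi => a * L psi + L' psi).
Proof.
move=> [p [pk ps Lp]] [q [qk qs Lq]].
exists (a *: p + q); split.
- rewrite (leq_trans (mpoly.msizeD_le _ _))// geq_max qk andbT.
  exact: leq_trans (mpoly.msizeZ_le _ _) pk.
- under eq_fun do rewrite mpoly.mevalD mpoly.mevalZ.
  by apply: SmoothAdd => //; apply: SmoothMul => //; exact: SmoothCst.
- move=> psi pt; rewrite Lp// Lq// -integral_rV_lin; last 2 first.
  + by apply: real_test_clipschitz; exact: real_test_mull.
  + by apply: real_test_clipschitz; exact: real_test_mull.
  congr integral_rV; apply/funext => x.
  by rewrite mpoly.mevalD mpoly.mevalZ mulrDl mulrA.
Qed.

Lemma poly_functional_scale n k a (L : ('rV[R]_n -> R) -> R) :
  poly_functional k L -> poly_functional k (fun psi => a * L psi).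
Proof.
move=> Lk; have := poly_functional_lin a Lk (poly_functional0 n k);
  congr poly_functional.
by apply/funext => psi; rewrite addr0.
Qed.

Lemma poly_functional_sum n k (I : Type) (s : seq I)
    (L : I -> ('rV[R]_n -> R) -> R) :
  (forall j, poly_functional k (L j)) ->
    poly_functional k (fun psi => \sum_(j <- s) L j psi).
Proof.
move=> Lk; elim: s => [|j s IH].
  by under eq_fun do rewrite big_nil; exact: poly_functional0.
have := poly_functional_lin 1 (Lk j) IH; congr poly_functional; apply/funext => psi.
by rewrite big_cons mul1r.
Qed.

Lemma poly_functional_coord n k (L : ('rV[R]_n -> R) -> R) j :
  poly_functional k L -> poly_functional k.+1 (fun psi => L (fun y =>
    y 0 j * psi y)).
Proof.
move=> [p [pk ps Lp]]; exists (mpoly.mpolyX R (mpoly.mnm1 j) * p); split.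
- have [->|p0] := eqVneq p 0; first by rewrite mulr0 mpoly.msize0.
  have X0 : mpoly.mpolyX R (mpoly.mnm1 j) != 0.
    by rewrite -mpoly.msize_poly_eq0 mpoly.msizeX.
  by rewrite mpoly.msizeM// mpoly.msizeX mpoly.mdeg1.
- under eq_fun do rewrite mpoly.mevalM mpoly.mevalXU.
  by apply: SmoothMul => //; exact: SmoothCoord.
- move=> psi pt; rewrite Lp; last exact: real_test_coord.
  congr integral_rV; apply/funext => x.
  by rewrite mpoly.mevalM mpoly.mevalXU mulrCA mulrA.
Qed.

(** At [t = 0], [smear] depends on [psi] only through its integral, and each
    step of the recursion multiplies [psi] by a coordinate: hence the
    dependence on [psi] is through its moments of order at most [k]. *)
Lemma smear_deriv_poly_functional n (F : ('rV[R]_n -> R) -> R) k phi :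
  real_dist F -> real_test phi -> poly_functional k.+1 (fun psi =>
    smear_deriv F k phi psi 0).
Proof.
move=> Fd; elim: k phi => [|k IH] phi ft.
  exists (mpoly.mpolyC n (F phi)); split.
  - by rewrite mpoly.msizeC; case: eqP.
  - under eq_fun do rewrite mpoly.mevalC; exact: SmoothCst.
  - move=> psi pt /=.
    under eq_fun do rewrite mpoly.mevalC.
    rewrite integral_rV_scale; last exact: real_test_clipschitz.
    rewrite mulrC -real_dist_scale//; congr F; apply/funext => u.
    by rewrite smear0// mulrC.
have := poly_functional_scale (-1) (@poly_functional_sum n k.+2 _ (index_enum
  'I_n) _
  (fun j => poly_functional_coord j (IH _ (real_test_partial j ft)))).
by congr poly_functional; apply/funext => psi /=; rewrite mulN1r.
Qed.

Lemma smear_by_parts_iter n (phi psi : 'rV[R]_n -> R) t s : real_test phi ->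
    real_test psi ->
  smear phi (partials s psi) t = fun u =>
    t ^+ size s * smear (partials s phi) psi t u.
Proof.
elim: s phi => [|j s IH] phi ft pt.
  by apply/funext => u; rewrite mul1r.
rewrite partials_cons smear_by_parts//; last exact: real_test_partials.
rewrite IH//; last exact: real_test_partial.
by apply/funext => u; rewrite /= exprS mulrA partials_partial.
Qed.

(** The [m]-th finite difference of the [m]-th power. With
    [theta p = 'X * p^`()], the sum is the value at [1] of the [m]-th iterate
    of [theta] on [('X - 1) ^+ m], and each iteration lowers the order of
    vanishing at [1] by one. *)
Lemma alternating_power_sum (m : nat) :
  \sum_(i < m.+1) 'C(m, i)%:R * (-1) ^+ (m - i) * i%:R ^+ m = m`!%:R :> R.
Proof.
pose theta (p : {poly R}) := 'X * p^`()%R.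
have factor_out (x d a b c q : {poly R}) :
    x * (b * a * q + d * a * c) = a * (x * (b * q + d * c)) by ring.
have thetaS k : exists q : {poly R}, (k <= m)%N ->
    iter k theta (('X - 1) ^+ m) = ('X - 1) ^+ (m - k) * q /\ q.[1] = (m ^_ k)%:R.
  elim: k => [|k [q IH]].
    by exists 1 => _; rewrite subn0 mulr1 hornerC.
  (* [q] is the cofactor of [('X - 1) ^+ (m - k)] after [k] iterations. *)
  exists ('X * ((m - k)%:R * q + ('X - 1) * q^`()%R)) => km.
  have [E q1] := IH (ltnW km); rewrite iterS E.
  have -> : (m - k = (m - k.+1).+1)%N by rewrite -subSn.
  split.
    rewrite /theta derivM deriv_exp derivB derivX derivC subr0 /= mul1r.
    rewrite exprS -mulr_natl.
    exact: factor_out.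
  rewrite hornerM hornerX hornerD !hornerM hornerD hornerN hornerX !hornerC.
  rewrite subrr mul0r addr0 mul1r q1 ffactnSr natrM mulrC.
  by rewrite subnSK// -polyC_natr hornerC.
have thetaE k : iter k theta (('X - 1) ^+ m) =
    \sum_(i < m.+1) ('C(m, i)%:R * (-1) ^+ (m - i) * i%:R ^+ k) *: 'X^i.
  elim: k => [|k IH].
    rewrite /= addrC exprDn; apply: eq_bigr => i _.
    rewrite mulr1 -mulr_natl -mul_polyC polyCM polyC_natr mulrA.
    by congr (_ * _ * _); rewrite rmorphXn rmorphN rmorph1.
  rewrite iterS IH /theta raddf_sum mulr_sumr; apply: eq_bigr => i _ /=.
  rewrite derivZ derivXn -scalerAr; case: i => -[|i] im /=.
    by rewrite mulr0n mulr0 scaler0 expr0n mulr0 scale0r.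
  by rewrite mulrnAr -exprS -['X^_ *+ _]scaler_nat scalerA
    [_%:R ^+ k.+1]exprSr mulrA.
have [q /(_ (leqnn m))[E q1]] := thetaS m.
have := congr1 (fun p => p.[1]) (thetaE m).
rewrite E subnn mul1r q1 ffactnn horner_sum => ->.
by apply: eq_bigr => i _; rewrite hornerZ hornerXn expr1n mulr1.
Qed.

(** The equation satisfied by [F], in which the second test function has been
    replaced by its dilation by [t]: the [m]-th difference with step [t] of
    [F (smear phi psi _)] at [0]. *)
Definition difference_eq n m (F : ('rV[R]_n -> R) -> R) :=
  forall phi psi, real_test phi -> real_test psi -> forall t, 0 < t ->
    (-1) ^+ m * (F phi * integral_rV psi) +
    \sum_(1 <= i < m.+1) 'C(m, i)%:R * (-1) ^+ (m - i) *
      F (smear phi psi (i%:R * t)) = 0.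

(** With [partials s psi] in place of [psi], where [s] has size [m], the term
    without smearing vanishes and each of the others has a factor
    [(i * t) ^ m]. Dividing by [t ^ m] and letting [t] go to [0] leaves
    [m! * F (partials s phi)] times the integral of [psi]. *)
Lemma difference_eq_kills n m (F : ('rV[R]_n -> R) -> R)
    (psi : 'rV[R]_n -> R) : (0 < m)%N ->
  real_dist F -> difference_eq m F -> real_test psi -> integral_rV psi != 0 ->
  kills_partials m F.
Proof.
move=> m0 Fd Feq pt Ipsi s phi sm ft.
pose chi := partials s phi.
have ct : real_test chi by exact: real_test_partials.
pose u t := F (smear chi psi t).
have u0 : u 0 = F chi * integral_rV psi.
  by rewrite /u mulrC -real_dist_scale//; congr F; apply/funext => x;
    rewrite smear0// mulrC.
have [C HC] := real_dist_time_quadratic Fd 0 ct pt.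
set a := \sum_j F (smear (partial j chi) (fun y => y 0 j * psi y) 0) in HC.
have Hu t : `|t| <= 1 -> `|u t - u 0| <= (`|C| + `|a|) * `|t|.
  move=> t1; have := HC 0 t; rewrite normr0 add0r -/(u t) -/(u 0) =>
    /(_ (lexx _) t1) H.
  rewrite -[u t - u 0](addrK (t * a)) (le_trans (ler_normB _ _))// mulrDl lerD//.
    apply: (le_trans H); rewrite -real_normK ?num_real//.
    apply: (@le_trans _ _ (`|C| * `|t| ^+ 2));
      first by rewrite ler_wpM2r// ?exprn_ge0// ler_norm.
    by rewrite ler_wpM2l// expr2 ler_piMr.
  by rewrite normrM mulrC.
(* The coefficients that are left once [t ^ m] is divided out. *)
pose c i : R := 'C(m, i)%:R * (-1) ^+ (m - i) * i%:R ^+ m.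
have Hsum t : 0 < t -> \sum_(1 <= i < m.+1) c i * u (i%:R * t) = 0.
  move=> t0; have := Feq phi (partials s psi) ft (real_test_partials s pt) t t0.
  have -> : integral_rV (partials s psi) = 0.
    case: s sm {chi ct u u0 a HC Hu} => [sm|j s _]; first by rewrite -sm in m0.
    by rewrite partials_cons integral_partial//; exact: real_test_partials.
  rewrite !mulr0 add0r => H.
  have tm : t ^+ m != 0 by rewrite expf_neq0// gt_eqF.
  apply: (mulfI tm); rewrite mulr0 mulr_sumr -[RHS]H; apply: eq_bigr => i _.
  rewrite smear_by_parts_iter// real_dist_scale//; last exact: smear_real_test.
  by rewrite sm -/(u _) exprMn /c; move: (u _) => v; ring.
have Csum : \sum_(1 <= i < m.+1) c i = m`!%:R.
  rewrite -[RHS]alternating_power_sum -(big_mkord xpredT c) big_ltn// {2}/c.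
    by rewrite expr0n gtn_eqF// mulr0 add0r.
have : m`!%:R * u 0 = 0.
  pose B := \sum_(1 <= i < m.+1) `|c i| * (`|C| + `|a|).
  apply: (@eq0_of_le_linear _ _ B) => e e0 e1.
  have m0' : (0 : R) < m%:R by rewrite ltr0n.
  have := Hsum (e / m%:R) (divr_gt0 e0 m0') => H.
  have -> : m`!%:R * u 0 = - \sum_(1 <= i < m.+1) c i * (u (i%:R * (e / m%:R))
    - u 0).
    transitivity (\sum_(1 <= i < m.+1) c i * u 0 -
        \sum_(1 <= i < m.+1) c i * u (i%:R * (e / m%:R))).
      by rewrite H subr0 -mulr_suml Csum.
    by rewrite -sumrB -sumrN; apply: eq_bigr => i _; rewrite mulrBr opprB.
  rewrite normrN (le_trans (ler_norm_sum _ _ _))// /B mulr_suml.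
  rewrite !big_nat; apply: ler_sum => i /andP[i1]; rewrite ltnS => im.
  have ie : `|i%:R * (e / m%:R)| <= e.
    rewrite ger0_norm; last by rewrite mulr_ge0// divr_ge0// ltW.
    rewrite mulrCA ler_piMr ?(ltW e0)//.
    by rewrite ler_pdivrMr// mul1r ler_nat.
  rewrite normrM -mulrA ler_wpM2l//.
  by rewrite (le_trans (Hu _ _)) ?(le_trans ie)// ler_wpM2l// addr_ge0.
move=> /eqP; rewrite u0 !mulf_eq0 (negbTE Ipsi) orbF pnatr_eq0 -leqn0 leqNgt
  fact_gt0 /=.
by move=> /eqP.
Qed.

(** Fix [psi] with nonzero integral. The equation at [t = 1] expresses [F phi]
    as a combination of the [F (smear phi psi i)], [1 <= i <= m]. By
    [smear_swap] these are values of [F] on the smearing of a fixed function by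
    [phi], which depend on [phi] through its moments of order less than [m],
    by [taylor_smear]. *)
Theorem difference_eq_poly_functional n m (F : ('rV[R]_n -> R) -> R) : (0 < m)%N ->
  real_dist F -> difference_eq m F -> poly_functional m F.
Proof.
move=> m0 Fd Feq.
(* If every test function is zero, then so is [F]. *)
have [[chi [ct [x chix]]]|none] :=
    pselect (exists chi : 'rV[R]_n -> R, real_test chi /\ exists x,
      chi x != 0); last first.
  have [p [pk ps Lp]] := poly_functional0 n m; exists p; split => // psi pt.
  rewrite -Lp// -(real_dist0 Fd); congr F; apply/funext => x.
  by apply/eqP/negPn/negP => H; apply: none; exists psi; split => //; exists x.
pose psi x := chi x * chi x.
have pt : real_test psi by apply: real_test_mull => //;
  apply: smooth_smooth_expr; case: ct.
have I0 : 0 < integral_rV psi.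
  apply: (@integral_rV_gt0 _ _ _ x); first exact: real_test_clipschitz.
    by move=> y; rewrite /psi -expr2 sqr_ge0.
  by rewrite /psi -expr2 exprn_even_gt0.
have Fk := difference_eq_kills m0 Fd Feq pt (lt0r_neq0 I0).
pose psi_ (i : nat) y := psi (i%:R^-1 *: y + 0).
(* The combination of Taylor expansions that the equation at [t = 1] gives. *)
pose G (phi : 'rV[R]_n -> R) := - (-1) ^+ m / integral_rV psi * \sum_(1 <= i < m.+1)
  ('C(m, i)%:R * (-1) ^+ (m - i) * (`|i%:R| ^+ n)^-1 *
   \sum_(k < m) k`!%:R^-1 * smear_deriv F k (psi_ i) phi 0).
have it i : (0 < i)%N -> real_test (psi_ i).
  by move=> i0; apply: real_test_affine => //; rewrite invr_eq0 pnatr_eq0 -lt0n.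
have FG phi : real_test phi -> F phi = G phi.
  move=> ft; have := Feq phi psi ft pt 1 ltr01.
  have E : \sum_(1 <= i < m.+1)
        'C(m, i)%:R * (-1) ^+ (m - i) * F (smear phi psi (i%:R * 1)) =
     \sum_(1 <= i < m.+1) ('C(m, i)%:R * (-1) ^+ (m - i) * (`|i%:R| ^+ n)^-1 *
   \sum_(k < m) k`!%:R^-1 * smear_deriv F k (psi_ i) phi 0).
    rewrite !big_nat; apply: eq_bigr => i /andP[i1 _].
    have i0 : i%:R != 0 :> R by rewrite pnatr_eq0 -lt0n.
    rewrite mulr1 smear_swap// real_dist_scale//; last first.
      by apply: smear_real_test => //; exact: it.
    by rewrite (taylor_smear Fd Fk (it i i1) ft) mulrA.
  rewrite E /G; move: (\sum_(1 <= i < m.+1) _) => S.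
  have I1 := lt0r_neq0 I0.
  have sg : (-1) ^+ m * (-1) ^+ m = 1 :> R by rewrite -expr2 sqrr_sign.
  move=> H; apply: (mulIf I1).
  have -> : - (-1) ^+ m / integral_rV psi * S * integral_rV psi =
    - (-1) ^+ m * S * (integral_rV psi / integral_rV psi) by ring.
  rewrite divff// mulr1.
  have {H} : S = - ((-1) ^+ m * (F phi * integral_rV psi)).
    by apply/eqP; rewrite -addr_eq0 addrC H.
  by move=> ->; rewrite mulrNN mulrA sg mul1r.
have GM : poly_functional m G.
  have -> : G = fun phi => - (-1) ^+ m / integral_rV psi * \sum_(0 <= i < m)
    ('C(m, i.+1)%:R * (-1) ^+ (m - i.+1) * (`|i.+1%:R| ^+ n)^-1 *
     \sum_(k < m) k`!%:R^-1 * smear_deriv F k (psi_ i.+1) phi 0).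
    by apply/funext => phi; rewrite /G big_add1.
  apply: poly_functional_scale.
  have := @poly_functional_sum n m _ (index_iota 0 m) (fun i phi =>
    'C(m, i.+1)%:R * (-1) ^+ (m - i.+1) * (`|i.+1%:R| ^+ n)^-1 *
   \sum_(k < m) k`!%:R^-1 * smear_deriv F k (psi_ i.+1) phi 0).
  apply => i; apply: poly_functional_scale; apply: poly_functional_sum => k;
    apply: poly_functional_scale.
  apply: (poly_functionalW (ltn_ord k));
    apply: smear_deriv_poly_functional => //; exact: it.
case: GM => p [pm ps Gp]; exists p; split => // phi ft.
by rewrite FG// Gp.
Qed.

End Diff.

(** * From real to complex distributions *)

Section Cplx.
Variable R : realType.
Local Open Scope classical_set_scope.

Import -(notations) mpoly.
Notation peval p := (fun x : 'rV[R]_(_) => mpoly.meval (fun i => x 0 i) p).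

Definition complexify n (g : 'rV[R]_n -> R) : 'rV[R]_n -> R[i] := fun x => (g x)%:C.

Lemma ReM (z w : R[i]) :
  complex.Re (z * w) = complex.Re z * complex.Re w - complex.Im z * complex.Im w.
Proof. by case: z => a b; case: w. Qed.

Lemma ImM (z w : R[i]) :
  complex.Im (z * w) = complex.Re z * complex.Im w + complex.Im z * complex.Re w.
Proof. by case: z => a b; case: w. Qed.

Lemma ReD (z w : R[i]) : complex.Re (z + w) = complex.Re z + complex.Re w.
Proof. by case: z => a b; case: w. Qed.

Lemma ImD (z w : R[i]) : complex.Im (z + w) = complex.Im z + complex.Im w.
Proof. by case: z => a b; case: w. Qed.

Lemma complex_ext (z w : R[i]) :
  complex.Re z = complex.Re w -> complex.Im z = complex.Im w -> z = w.
Proof. by case: z => a b; case: w => c d /= -> ->. Qed.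

Lemma support_ball n (phi : 'rV[R]_n -> R[i]) M :
  (forall x, M < `|x| -> phi x = 0) -> support_of phi `<=` [set x | `|x| <= M].
Proof.
move=> fM; rewrite /support_of.
have cb := @ball_closed R n M.
rewrite [X in _ `<=` X](closure_id _).1//; apply: closureS => x /= fx.
by rewrite leNgt; apply: contra fx => /fM ->.
Qed.

Lemma test_function_complexify n (g : 'rV[R]_n -> R) : real_test g ->
    test_function (complexify g).
Proof.
move=> gt; have [M [M0 gM]] := real_test_radius gt; split.
- by case: gt.
- by have [] := real_test0 R n.
- apply: (subclosed_compact _ (@ball_compact R n M)); first exact: closed_closure.
  by apply: support_ball => x Mx; rewrite /complexify gM.
Qed.

Lemma test_function_bounded_support n
    (phi : 'rV[R]_n -> R[i]) : test_function phi ->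
  exists M, forall x, M < `|x| -> phi x = 0.
Proof.
move=> [_ _ /compact_bounded[M [_ HM]]]; exists (`|M| + 1) => x Mx.
apply/eqP/negPn/negP => fx.
have := HM (`|M| + 1); rewrite (le_lt_trans (ler_norm M)) ?ltrDl// => /(_ isT x).
rewrite /globally /= => H; have {}fx : support_of phi x by exact:
  (@subset_closure _ [set y | phi y != 0]).
have := H fx.
by rewrite leNgt Mx.
Qed.

Lemma real_test_Re n (phi : 'rV[R]_n -> R[i]) : test_function phi ->
  real_test (fun x => complex.Re (phi x)).
Proof.
move=> ft; have [M fM] := test_function_bounded_support ft.
by case: ft => fs _ _; split => //; exists M => x /fM ->.
Qed.

Lemma real_test_Im n (phi : 'rV[R]_n -> R[i]) : test_function phi ->
  real_test (fun x => complex.Im (phi x)).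
Proof.
move=> ft; have [M fM] := test_function_bounded_support ft.
by case: ft => _ fs _; split => //; exists M => x /fM ->.
Qed.

Lemma normc_real (r : R) : Normc.normc (r%:C) = `|r|.
Proof. by rewrite /Normc.normc /= expr0n addr0 sqrtr_sqr. Qed.

Lemma Re_le_normc (z : R[i]) : `|complex.Re z| <= Normc.normc z.
Proof.
case: z => a b /=; rewrite -sqrtr_sqr ler_wsqrtr// lerDl sqr_ge0//.
Qed.

Lemma Im_le_normc (z : R[i]) : `|complex.Im z| <= Normc.normc z.
Proof.
case: z => a b /=; rewrite -sqrtr_sqr ler_wsqrtr// lerDr sqr_ge0//.
Qed.

(** The lower bound is there because the constant in the continuity estimate of
    a distribution may be negative. *)
Lemma seminorm_complexify n N (phi : 'rV[R]_n -> R) (B : R) :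
  (forall s x, (size s <= N)%N -> `|partials s phi x| <= B) ->
  0 <= seminorm N (complexify phi) <= B.
Proof.
move=> fB.
have E s x : Normc.normc (partialsC s (complexify phi) x) = `|partials s phi x|.
  by rewrite /partialsC /complexify /= partials0; exact: normc_real.
have ub : ubound [set r | exists (s : seq 'I_n) (x : 'rV[R]_n),
         (size s <= N)%N /\ r = Normc.normc (partialsC s (complexify phi) x)] B.
  by move=> r [s [x [sN ->]]]; rewrite E; exact: fB.
have ne : [set r | exists (s : seq 'I_n) (x : 'rV[R]_n),
         (size s <= N)%N /\ r = Normc.normc (partialsC s (complexify phi) x)]
           (Normc.normc (partialsC [::] (complexify phi) 0)).
  by exists [::], 0.
apply/andP; split; last by apply: ge_sup => //; eexists; exact: ne.
apply: (@le_trans _ _ (Normc.normc (partialsC [::] (complexify phi) 0))).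
  by rewrite E.
by apply: ub_le_sup => //; exists B.
Qed.

Lemma distribution_complexify_lin n (f : ('rV[R]_n -> R[i]) ->
    R[i]) (a : R) phi psi :
  is_distribution f -> real_test phi -> real_test psi ->
  f (complexify (fun x => a * phi x + psi x)) = a%:C * f (complexify phi) +
    f (complexify psi).
Proof.
move=> fd ft pt; rewrite -fd.1; [|exact: test_function_complexify|exact:
  test_function_complexify].
congr f; apply/funext => x; apply: complex_ext; rewrite /complexify /=; ring.
Qed.

Lemma distribution_complexify_bound n (f : ('rV[R]_n -> R[i]) -> R[i]) (M : R) :
  is_distribution f -> exists (C : R) (N : nat), forall phi (B : R),
    real_test phi ->
     vanishes_beyond M phi ->
     (forall s x, (size s <= N)%N -> `|partials s phi x| <= B) ->
     Normc.normc (f (complexify phi)) <= C * B.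
Proof.
move=> fd; have [C [N HC]] := fd.2 _ (@ball_compact R n M).
exists `|C|, N => phi B ft fM fB.
have /andP[s0 sB] := seminorm_complexify fB.
apply: (le_trans (HC _ (test_function_complexify ft) _)).
  by apply: support_ball => x Mx; rewrite /complexify fM.
apply: (le_trans (ler_wpM2r s0 (ler_norm C))).
exact: ler_wpM2l.
Qed.

Lemma real_dist_Re n (f : ('rV[R]_n -> R[i]) -> R[i]) : is_distribution f ->
  real_dist (fun g => complex.Re (f (complexify g))).
Proof.
move=> fd; split => [a phi psi ft pt|M].
  by rewrite distribution_complexify_lin// ReD ReM /= mul0r subr0.
have [C [N HC]] := distribution_complexify_bound M fd;
  exists C, N => phi B ft fM fB.
exact: le_trans (Re_le_normc _) (HC _ _ ft fM fB).
Qed.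

Lemma real_dist_Im n (f : ('rV[R]_n -> R[i]) -> R[i]) : is_distribution f ->
  real_dist (fun g => complex.Im (f (complexify g))).
Proof.
move=> fd; split => [a phi psi ft pt|M].
  by rewrite distribution_complexify_lin// ImD ImM /= mul0r addr0.
have [C [N HC]] := distribution_complexify_bound M fd;
  exists C, N => phi B ft fM fB.
exact: le_trans (Im_le_normc _) (HC _ _ ft fM fB).
Qed.

Lemma integralC_complexify n
    (g : 'rV[R]_n -> R) : integralC (complexify g) = (integral_rV g)%:C.
Proof.
by apply: complex_ext => //=; rewrite integral_rV0.
Qed.

Lemma convolution_complexify n (phi psi : 'rV[R]_n -> R) u :
  convolution (complexify phi) (complexify psi) u = (smear phi psi 1 u)%:C.
Proof.
rewrite -integralC_complexify; congr integralC; apply/funext => v.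
by apply: complex_ext; rewrite /complexify /= ?scale1r; ring.
Qed.

Lemma real_test_prod d (phi psi : 'rV[R]_d -> R) : real_test phi -> real_test psi ->
  real_test (fun z : 'rV[R]_(d + d) => phi (lsubmx z) * psi (rsubmx z)).
Proof.
move=> ft pt; split.
  apply: smooth_expr_smooth; apply: SmoothMul.
    by apply: smooth_expr_lsub; case: ft.
  by apply: smooth_expr_rsub; case: pt.
have [M [M0 fM]] := real_test_radius ft; have [N [N0 pN]] := real_test_radius pt.
exists (M + N) => z Mz.
have [zM|zM] := leP `|lsubmx z| M; last by rewrite fM// mul0r.
have [zN|zN] := leP `|rsubmx z| N; last by rewrite pN// mulr0.
exfalso; move: Mz; apply/negP; rewrite -leNgt.
apply: norm_rV_le => [|j]; first exact: addr_ge0.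
rewrite -(splitK j); case: (fintype.split j) => k /=.
  have := coord_le_norm (lsubmx z) k; rewrite mxE => H.
  by rewrite (le_trans H)// (le_trans zM)// lerDl.
have := coord_le_norm (rsubmx z) k; rewrite mxE => H.
by rewrite (le_trans H)// (le_trans zN)// lerDr.
Qed.

Lemma prod_fun_complexify d (phi psi : 'rV[R]_d -> R) :
  prod_fun (complexify phi) (complexify psi) =
  complexify (fun z : 'rV[R]_(d + d) => phi (lsubmx z) * psi (rsubmx z)).
Proof.
by apply/funext => z; apply: complex_ext; rewrite /prod_fun /complexify /=; ring.
Qed.

(** The substitution [v = i *: y] in the convolution absorbs the determinant
    factor. *)
Lemma comp_affine_complexify d (f : ('rV[R]_d -> R[i]) -> R[i]) (i : nat) G
    (phi psi : 'rV[R]_d -> R) : (0 < i)%N ->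
  is_comp_affine f (1%:M : 'M[R]_d) ((i%:R)%:M : 'M[R]_d) G ->
  real_test phi -> real_test psi ->
  G (prod_fun (complexify phi) (complexify psi)) = f (complexify (smear phi psi
    i%:R)).
Proof.
move=> i0 [_ Gdef] ft pt; have i1 : 0 < i%:R :> R by rewrite ltr0n.
rewrite Gdef; [|exact: test_function_complexify|exact: test_function_complexify].
congr f; apply/funext => u.
have -> : sigma (invmx 1%:M) (complexify phi) = complexify phi.
  by apply/funext => x; rewrite /sigma invmx1 trmx1 mulmx1.
have -> : sigma (invmx i%:R%:M) (complexify psi) = complexify (fun y =>
  psi (i%:R^-1 *: y + 0)).
  by apply/funext => x; rewrite /sigma invmx_scalar tr_scalar_mx mul_mx_scalar
    /complexify addr0.
rewrite convolution_complexify smear_dilate// det1 det_scalar normr1 mul1r.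
rewrite ger0_norm ?exprn_ge0 ?(ltW i1)//.
apply: complex_ext; rewrite /complexify /= ?mul1r; last by ring.
by rewrite mul0r subr0 mulKf// expf_neq0// gt_eqF.
Qed.

(** The second test function is [psi] dilated by [t] and normalized to keep its
    integral. *)
Lemma difference_eq_complexify d m (f : ('rV[R]_d -> R[i]) -> R[i]) G0 G :
  is_distribution f -> is_tensor_one f G0 ->
  (forall i : nat, (1 <= i <= m)%N ->
       is_comp_affine f (1%:M : 'M[R]_d) ((i%:R)%:M : 'M[R]_d) (G i)) ->
  (forall Phi : 'rV[R]_(d + d) -> R[i], test_function Phi ->
       (-1) ^+ m * G0 Phi
       + \sum_(1 <= i < m.+1) ('C(m, i))%:R * (-1) ^+ (m - i) * G i Phi = 0) ->
  forall phi psi, real_test phi -> real_test psi -> forall t, 0 < t ->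
    ((-1) ^+ m)%:C * (f (complexify phi) * (integral_rV psi)%:C) +
    \sum_(1 <= i < m.+1) ('C(m, i)%:R * (-1) ^+ (m - i))%:C
       * f (complexify (smear phi psi (i%:R * t))) = 0.
Proof.
move=> fd [_ G0def] Gdef Heq phi psi ft pt t t0.
have t1 : t^-1 != 0 by rewrite invr_eq0 gt_eqF.
have tn : t ^+ d != 0 by rewrite expf_neq0// gt_eqF.
(* [psi_t] has the integral of [psi], and smearing by it at time [i] is
   smearing by [psi] at time [i * t]. *)
pose psi_t y := (t ^+ d)^-1 * psi (t^-1 *: y + 0).
have ptt : real_test psi_t by apply: real_test_scale; exact: real_test_affine.
have Et i : smear phi psi_t i = smear phi psi (i * t).
  apply/funext => u; apply: (mulfI tn).
  have := smear_dilate i ft pt t0 => /(congr1 (fun g => g u)) <-.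
  rewrite /smear -integral_rV_scale; last exact: smear_clipschitz
    (real_test_clipschitz ptt).
  congr integral_rV; apply/funext => y; rewrite /psi_t.
  by rewrite mulrCA mulVKf.
have It : integral_rV psi_t = integral_rV psi.
  rewrite /psi_t integral_rV_scale; last first.
    by apply: real_test_clipschitz; exact: real_test_affine.
  rewrite integral_rV_affine//; last exact: real_test_clipschitz.
  by rewrite normfV gtr0_norm// exprVn invrK mulKf.
have := Heq (prod_fun (complexify phi) (complexify psi_t)).
rewrite {1}prod_fun_complexify =>
  /(_ (test_function_complexify (real_test_prod ft ptt))).
rewrite G0def; [|exact: test_function_complexify|exact: test_function_complexify].
rewrite integralC_complexify It => H; rewrite -[RHS]H; congr (_ * _ + _).
  by rewrite rmorphXn rmorphN rmorph1.
rewrite !big_nat; apply: eq_bigr => i im.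
rewrite (comp_affine_complexify _ (Gdef i im) ft ptt); last by case/andP: im.
by rewrite Et rmorphM rmorphXn rmorphN rmorph1 rmorph_nat.
Qed.

Lemma Re_sum (I : Type) (r : seq I) (g : I -> R[i]) :
  complex.Re (\sum_(i <- r) g i) = \sum_(i <- r) complex.Re (g i).
Proof. by elim: r => [|i r IH]; rewrite ?big_nil// !big_cons ReD IH. Qed.

Lemma Im_sum (I : Type) (r : seq I) (g : I -> R[i]) :
  complex.Im (\sum_(i <- r) g i) = \sum_(i <- r) complex.Im (g i).
Proof. by elim: r => [|i r IH]; rewrite ?big_nil// !big_cons ImD IH. Qed.

Lemma meval_real n (p : mpoly.mpoly n R) (x : 'rV[R]_n) :
  mpoly.meval (fun i => (x 0 i)%:C) (mpoly.map_mpoly (real_complex R) p) =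
  (peval p x)%:C.
Proof.
rewrite /= (mpoly.map_mpolyE _ (leqnn _)) (raddf_sum (mpoly.meval _)).
have := congr1 (mpoly.meval (fun i => x 0 i))
  (mpoly.mpolywE (leqnn (mpoly.msize p))).
rewrite (raddf_sum (mpoly.meval _)) => ->.
rewrite (rmorph_sum (real_complex R)).
apply: eq_bigr => mu _ /=.
rewrite !mpoly.mevalZ !mpoly.mevalX.
rewrite (rmorphM (real_complex R)) rmorph_prod; congr (_ * _).
by apply: eq_bigr => j _; rewrite rmorphXn.
Qed.

Lemma test_function_split n (f : ('rV[R]_n -> R[i]) -> R[i]) phi :
  is_distribution f -> test_function phi ->
  f phi = (0 +i* 1) * f (complexify (fun x => complex.Im (phi x))) +
          f (complexify (fun x => complex.Re (phi x))).
Proof.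
move=> fd ft; rewrite -fd.1; last 2 first.
- by apply: test_function_complexify; exact: real_test_Im.
- by apply: test_function_complexify; exact: real_test_Re.
congr f; apply/funext => x; apply: complex_ext; rewrite /complexify /=; ring.
Qed.

Lemma mpoly_comb n (S : comNzRingType) (a : S) (p q : mpoly.mpoly n S) :
  exists r : mpoly.mpoly n S,
    (forall mu, mpoly.mcoeff mu r = a * mpoly.mcoeff mu p + mpoly.mcoeff mu q) /\
    (forall v, mpoly.meval v r = a * mpoly.meval v p + mpoly.meval v q).
Proof.
exists (a *: p + q); split => [mu|v].
  by rewrite mpoly.mcoeffD mpoly.mcoeffZ.
by rewrite mpoly.mevalD mpoly.mevalZ.
Qed.

Lemma mpoly_complex n (p q : mpoly.mpoly n R) :
  exists r : mpoly.mpoly n R[i],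
    (forall mu, mpoly.mcoeff mu p = 0 -> mpoly.mcoeff mu q = 0 ->
       mpoly.mcoeff mu r = 0) /\
    (forall x : 'rV[R]_n,
       mpoly.meval (fun i => (x 0 i)%:C) r = peval p x +i* peval q x).
Proof.
have mapC (a : mpoly.mpoly n R) : exists P : mpoly.mpoly n R[i],
    (forall mu, mpoly.mcoeff mu P = (mpoly.mcoeff mu a)%:C) /\
    (forall x : 'rV[R]_n, mpoly.meval (fun i => (x 0 i)%:C) P = (peval a x)%:C).
  exists (mpoly.map_mpoly (real_complex R) a); split => [mu|x].
    by rewrite mpoly.mcoeff_map_mpoly.
  exact: meval_real.
have [P [Pc Pe]] := mapC p; have [Q [Qc Qe]] := mapC q.
have [r [rc re]] := mpoly_comb (0 +i* 1 : R[i]) Q P.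
exists r; split => [mu p0 q0|x].
  by rewrite rc Pc Qc p0 q0 mulr0 addr0.
by rewrite re Pe Qe; apply: complex_ext; rewrite ?ReD ?ImD ?ReM ?ImM /=; ring.
Qed.

(** The coefficients of the difference equation are real, so that it splits
    into two equations, for the real distributions [Re f] and [Im f]. *)
Theorem poly_of_difference_eq d m (f : ('rV[R]_d -> R[i]) -> R[i]) : (0 < m)%N ->
  is_distribution f ->
  (forall phi psi, real_test phi -> real_test psi -> forall t, 0 < t ->
    ((-1) ^+ m)%:C * (f (complexify phi) * (integral_rV psi)%:C) +
    \sum_(1 <= i < m.+1) ('C(m, i)%:R * (-1) ^+ (m - i))%:C
       * f (complexify (smear phi psi (i%:R * t))) = 0) ->
  exists p : mpoly.mpoly d R[i],
    (forall mu : mpoly.multinom d,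
       mpoly.mcoeff mu p != 0 -> (mpoly.mdeg mu <= m - 1)%N) /\
    forall phi : 'rV[R]_d -> R[i], test_function phi ->
      f phi = poly_distribution p phi.
Proof.
move=> m0 fd Heq.
have [|p1 [p1m p1s F1]] := difference_eq_poly_functional m0 (real_dist_Re fd).
  move=> phi psi ft pt t t0; have := congr1 (@complex.Re R) (Heq phi psi ft pt
    t t0).
  rewrite ReD !ReM /= Re_sum => H; rewrite -[RHS]H; congr (_ + _); first by ring.
  by apply: eq_bigr => i _; rewrite ReM /= mul0r subr0.
have [|p2 [p2m p2s F2]] := difference_eq_poly_functional m0 (real_dist_Im fd).
  move=> phi psi ft pt t t0; have := congr1 (@complex.Im R) (Heq phi psi ft pt
    t t0).
  rewrite ImD !ImM /= Im_sum => H; rewrite -[RHS]H; congr (_ + _); first by ring.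
  by apply: eq_bigr => i _; rewrite ImM /= mul0r addr0.
have [P [Pcoef Pval]] := mpoly_complex p1 p2.
exists P; split => [mu|phi ft].
  move=> mu0; rewrite subn1 -ltnS prednK// ltnNge; apply: contra mu0 => mmu.
  have c0 (p : mpoly.mpoly d R) : (mpoly.msize p <= m)%N -> mpoly.mcoeff mu p = 0.
    move=> pm; apply: mpoly.memN_msupp_eq0.
    by apply: mpoly.msize_mdeg_ge; exact: leq_trans mmu.
  by rewrite Pcoef//; exact: c0.
have rt := real_test_Re ft; have it := real_test_Im ft.
have evalE (x : 'rV[R]_d) : mpoly.meval (fun i => (x 0 i)%:C) P * phi x =
  ((peval p1 x * complex.Re (phi x) - peval p2 x * complex.Im (phi x)) +i*
   (peval p1 x * complex.Im (phi x) + peval p2 x * complex.Re (phi x))).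
  rewrite Pval.
  by apply: complex_ext; rewrite ?ReM ?ImM /=; ring.
rewrite (test_function_split fd ft) /poly_distribution.
rewrite (funext evalE).
have l p g : smooth_expr (peval p) -> real_test g ->
  clipschitz (fun x => peval p x * g x).
  by move=> ps gt; apply: real_test_clipschitz; exact: real_test_mull.
apply: complex_ext; rewrite ?ReD ?ImD ?ReM ?ImM /integralC /=.
  rewrite mul0r mul1r sub0r F1// F2//.
  rewrite -mulN1r -integral_rV_lin; last 2 first.
  - exact: l.
  - exact: l.
  by congr integral_rV; apply/funext => x; rewrite mulN1r addrC.
rewrite mul0r mul1r add0r F1// F2//.
rewrite -[X in X + _]mul1r -integral_rV_lin; last 2 first.
- exact: l.
- exact: l.
by congr integral_rV; apply/funext => x; rewrite mul1r.
Qed.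

End Cplx.

Unset Implicit Arguments.

(* G0 is f(x).1(y) and G i is f(x + i y). The polynomial p has
   total degree <= m - 1: mpoly.mcoeff mu p is its coefficient at the monomial
   with exponents mu, whose total degree is mpoly.mdeg mu. *)
Theorem theorem11 (R : realType) (d m : nat)
    (d_ge1 : (1 <= d)%N) (m_ge1 : (1 <= m)%N)
    (f : ('rV[R]_d -> R[i]) -> R[i]) (f_distr : is_distribution f)
    (G0 : ('rV[R]_(d + d) -> R[i]) -> R[i])
    (G : nat -> ('rV[R]_(d + d) -> R[i]) -> R[i])
    (G0_def : is_tensor_one f G0)
    (G_def : forall i : nat, (1 <= i <= m)%N ->
       is_comp_affine f (1%:M : 'M[R]_d) ((i%:R)%:M : 'M[R]_d) (G i))
    (diff_eq0 : forall Phi : 'rV[R]_(d + d) -> R[i], test_function Phi ->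
       (-1) ^+ m * G0 Phi
       + \sum_(1 <= i < m.+1) ('C(m, i))%:R * (-1) ^+ (m - i) * G i Phi = 0) :
  exists p : mpoly.mpoly d R[i],
    (forall mu : mpoly.multinom d,
       mpoly.mcoeff mu p != 0 -> (mpoly.mdeg mu <= m - 1)%N) /\
    forall phi : 'rV[R]_d -> R[i], test_function phi ->
      f phi = poly_distribution p phi.
Proof.
apply: poly_of_difference_eq => //.
exact: difference_eq_complexify f_distr G0_def G_def diff_eq0.
Qed.
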